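(* Let $x\in\{l,u\}$. The functor $\mathcal P_x\mathcal V:\mathbf{Dom}\to\mathbf{Dom}$ is strong: for all domains $X,Y$ there is a tensorial strength $\mathrm{str}_{X,Y}: X\times\mathcal P_x\mathcal V(Y)\to\mathcal P_x\mathcal V(X\times Y)$ (continuous, natural in $X,Y$, and satisfying the usual strength axioms) which is determined on basic elements by $$(a,\,x(F))\mapsto x\big(\{\delta_a\otimes\mu\mid \mu\in F\}\big),\qquad\text{where } \delta_a\otimes \textstyle\sum_i p_i\cdot y_i=\sum_i p_i\cdot (a,y_i)$$ for every finite set $F$ of finite linear combinations of point masses. The same holds for $x=b$, with $\mathcal P_b\mathcal V:\mathbf{CohDom}\to\mathbf{CohDom}$ in place of $\mathbf{Dom}$.
   Context: $\mathbf{Dom}$ is the category of domains (continuous directed-complete posets) and Scott-continuous maps; $\mathbf{CohDom}$ its full subcategory of coherent domains (domains in which the intersection of two compact saturated sets is compact). For a domain $X$, $\mathcal V(X)$ is the set of continuous valuations on $X$ (maps $\mu$ from Scott-opens to $[0,\infty]$ that are strict, monotone, modular and preserve directed unions), ordered pointwise; it is a continuous d-cone (a real cone which is a continuous dcpo with Scott-continuous addition and scalar multiplication) with basis the finite combinations $\sum_i r_i\cdot x_i:=\sum_i r_i\delta_{x_i}$ of point masses $\delta_x$; $\mathcal V(f)(\sum_i r_i\cdot x_i)=\sum_i r_i\cdot f(x_i)$. For a continuous d-cone $C$: $\mathcal P_l(C)$ is the set of nonempty Scott-closed convex subsets ordered by $A\le_l B$ iff ${\downarrow}A\subseteq{\downarrow}B$;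 $\mathcal P_u(C)$ the nonempty compact saturated convex subsets ordered by $A\le_u B$ iff ${\uparrow}B\subseteq{\uparrow}A$; for Lawson-compact $C$, $\mathcal P_b(C)$ the nonempty convex, Lawson-compact, order-convex subsets ordered by the conjunction of both conditions. For finite $F\subseteq C$, $l(F)=\overline{\mathrm{conv}\,F}$ (Scott closure of the convex hull), $u(F)={\uparrow}\mathrm{conv}\,F$, $b(F)=l(F)\cap{\uparrow}\mathrm{conv}\,F$; the sets $x(F)$ form a basis of $\mathcal P_x(C)$. The composite $\mathcal P_x\mathcal V$ is a monad (on $\mathbf{Dom}$ for $x\in\{l,u\}$, on $\mathbf{CohDom}$ for $x=b$) with unit $a\mapsto x(\{\delta_a\})$. *)

(* Defs.v *)
From HB Require Import structures.
From mathcomp Require Import all_boot all_order all_algebra.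
From mathcomp Require Import boolp classical_sets reals constructive_ereal ereal Rstruct.
Set Implicit Arguments. Unset Strict Implicit. Unset Printing Implicit Defensive.
Import Order.TTheory GRing.Theory Num.Theory.
Local Open Scope classical_set_scope.
Local Open Scope ring_scope.

Notation ERreal := Rdefinitions.R.

(* Order theory relative to a carrier predicate P on a type T.            *)
(* For domains the carrier is setT; for V(Y) it is is a continuous       *)
(* valuation; for P_x V(Y) it is is a valid element of P_x.            *)
Section OrderIn.
Variables (T : Type) (P : set T) (le : T -> T -> Prop).

Definition upper_bound (D : set T) (u : T) := forall d, D d -> le d u.

Definition is_lub (D : set T) (s : T) :=
  P s /\ upper_bound D s /\ (forall u, P u -> upper_bound D u -> le s u).

Definition directed (D : set T) :=
  D `<=` P /\ (exists d, D d) /\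
  (forall x y, D x -> D y -> exists z, D z /\ le x z /\ le y z).

Definition upset (A : set T) : set T := fun y => P y /\ exists x, A x /\ le x y.
Definition downset (A : set T) : set T := fun y => P y /\ exists x, A x /\ le y x.

Definition saturated (A : set T) :=
  forall x y, A x -> P y -> le x y -> A y.

Definition order_convex (A : set T) :=
  forall x y z, A x -> A z -> P y -> le x y -> le y z -> A y.

Definition scott_open (U : set T) :=
  U `<=` P /\ saturated U /\
  (forall D s, directed D -> is_lub D s -> U s -> exists d, D d /\ U d).

Definition scott_closed (A : set T) := A `<=` P /\ scott_open (P `\` A).

Definition scott_closure (A : set T) : set T :=
  fun x => P x /\ forall C, scott_closed C -> A `<=` C -> C x.

Definition compact_wrt (opens : set (set T)) (K : set T) :=
  K `<=` P /\
  forall (I : Type) (U : I -> set T), (forall i, opens (U i)) ->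
    K `<=` (fun x => exists i, U i x) ->
    exists s : seq I, K `<=` (fun x => exists i, List.In i s /\ U i x).

Definition scott_compact (K : set T) := compact_wrt scott_open K.

Definition lawson_subbasic (S : set T) :=
  scott_open S \/ exists z, P z /\ S = P `\` upset [set z].

Definition lawson_open (U : set T) :=
  U `<=` P /\
  forall x, U x -> exists Ss : seq (set T),
    (forall S, List.In S Ss -> lawson_subbasic S) /\
    (forall S, List.In S Ss -> S x) /\
    (fun y => P y /\ forall S, List.In S Ss -> S y) `<=` U.

Definition lawson_compact (K : set T) := compact_wrt lawson_open K.

End OrderIn.

Definition scott_cont (A B : Type) (PA : set A) (leA : A -> A -> Prop)
    (PB : set B) (leB : B -> B -> Prop) (f : A -> B) :=
  (forall a, PA a -> PB (f a)) /\
  (forall a a', PA a -> PA a' -> leA a a' -> leB (f a) (f a')) /\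
  (forall D s, directed PA leA D -> is_lub PA leA D s ->
     is_lub PB leB (f @` D) (f s)).

Section Domains.
Variables (X : Type) (le : X -> X -> Prop).

Definition is_poset :=
  (forall x, le x x) /\ (forall x y z, le x y -> le y z -> le x z) /\
  (forall x y, le x y -> le y x -> x = y).

Definition is_dcpo :=
  is_poset /\ forall D, directed setT le D -> exists s, is_lub setT le D s.

Definition way_below (x y : X) :=
  forall D s, directed setT le D -> is_lub setT le D s -> le y s ->
    exists d, D d /\ le x d.

Definition is_domain :=
  is_dcpo /\
  forall y, directed setT le (fun x => way_below x y) /\
            is_lub setT le (fun x => way_below x y) y.

Definition is_coherent_domain :=
  is_domain /\
  forall K1 K2, scott_compact setT le K1 -> saturated setT le K1 ->
                scott_compact setT le K2 -> saturated setT le K2 ->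
                scott_compact setT le (K1 `&` K2).

End Domains.

Definition prod_le (X Y : Type) (leX : X -> X -> Prop) (leY : Y -> Y -> Prop)
  (p q : X * Y) := leX p.1 q.1 /\ leY p.2 q.2.

Definition unit_le (_ _ : unit) := True.

(* Continuous valuations.  A valuation is represented as a function on    *)
(* all subsets, normalised to be 0 on non-Scott-open subsets, so that     *)
(* equality of valuations is equality of functions.                       *)
Definition valT (Y : Type) := set Y -> \bar ERreal.

Section Valuations.
Local Open Scope ereal_scope.
Variables (Y : Type) (leY : Y -> Y -> Prop).

Definition sopen (U : set Y) := scott_open setT leY U.

Definition is_cval (mu : valT Y) :=
  (forall U, ~ sopen U -> mu U = 0) /\
  (forall U, 0 <= mu U) /\
  mu set0 = 0 /\
  (forall U V, sopen U -> sopen V -> U `<=` V -> mu U <= mu V) /\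
  (forall U V, sopen U -> sopen V -> mu U + mu V = mu (U `|` V) + mu (U `&` V)) /\
  (forall D : set (set Y), (forall U, D U -> sopen U) -> (exists U, D U) ->
     (forall U V, D U -> D V -> exists W, D W /\ U `<=` W /\ V `<=` W) ->
     mu (\bigcup_(U in D) U) = ereal_sup [set mu U | U in D]).

Definition le_val (mu nu : valT Y) := forall U, mu U <= nu U.

Definition dirac (a : Y) : valT Y :=
  fun U => if `[< sopen U /\ U a >] then 1 else 0.

Definition simple (s : seq (ERreal * Y)) : valT Y :=
  fun U => \sum_(p <- s) (p.1)%:E * dirac p.2 U.

Definition nonneg_coeffs (s : seq (ERreal * Y)) := forall p, List.In p s -> (0 <= p.1)%R.

Definition conv (L : seq (valT Y)) : set (valT Y) :=
  fun nu => exists w : seq ERreal,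
    size w = size L /\ (forall r, List.In r w -> (0 <= r)%R) /\
    (\sum_(r <- w) r = 1)%R /\
    nu = (fun U => \sum_(p <- zip w L) (p.1)%:E * p.2 U).

Definition convex (A : set (valT Y)) :=
  forall mu nu (t : ERreal), A mu -> A nu -> (0 <= t <= 1)%R ->
    A (fun U => t%:E * mu U + (1 - t)%:E * nu U).

End Valuations.

Definition Vmap (Y Z : Type) (leZ : Z -> Z -> Prop) (f : Y -> Z) (mu : valT Y) : valT Z :=
  fun U => if `[< sopen leZ U >] then mu (f @^-1` U) else 0%E.

Inductive pkind := Pl | Pu | Pb.

Section Powerdomains.
Variables (Y : Type) (leY : Y -> Y -> Prop).

Let C := is_cval leY.
Let leV := @le_val Y.

Definition validP (x : pkind) (A : set (valT Y)) :=
  match x with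
  | Pl => (exists mu, A mu) /\ scott_closed C leV A /\ convex A
  | Pu => (exists mu, A mu) /\ scott_compact C leV A /\ saturated C leV A /\ convex A
  | Pb => (exists mu, A mu) /\ convex A /\ lawson_compact C leV A /\
          order_convex C leV A
  end.

Definition leP (x : pkind) (A B : set (valT Y)) :=
  match x with
  | Pl => downset C leV A `<=` downset C leV B
  | Pu => upset C leV B `<=` upset C leV A
  | Pb => downset C leV A `<=` downset C leV B /\ upset C leV B `<=` upset C leV A
  end.

Definition basicP (x : pkind) (F : seq (valT Y)) : set (valT Y) :=
  match x with
  | Pl => scott_closure C leV (conv F)
  | Pu => upset C leV (conv F)
  | Pb => scott_closure C leV (conv F) `&` upset C leV (conv F)
  end.

End Powerdomains.

Definition Pmap (Z : Type) (leZ : Z -> Z -> Prop) (x : pkind) (Y : Type)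
    (g : valT Y -> valT Z) (A : set (valT Y)) : set (valT Z) :=
  match x with
  | Pl => scott_closure (is_cval leZ) (@le_val Z) (g @` A)
  | Pu => upset (is_cval leZ) (@le_val Z) (g @` A)
  | Pb => scott_closure (is_cval leZ) (@le_val Z) (g @` A) `&`
          upset (is_cval leZ) (@le_val Z) (g @` A)
  end.

Definition PVmap (x : pkind) (Y Z : Type) (leZ : Z -> Z -> Prop) (f : Y -> Z) :=
  Pmap leZ x (Vmap leZ f).

Definition tensor (X Y : Type) (a : X) (s : seq (ERreal * Y)) : seq (ERreal * (X * Y)) :=
  [seq (p.1, (a, p.2)) | p <- s].

Definition good_dom (x : pkind) (X : Type) (le : X -> X -> Prop) :=
  match x with Pb => is_coherent_domain le | _ => is_domain le end.

Definition str_family :=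
  forall (X Y : Type), (X -> X -> Prop) -> (Y -> Y -> Prop) ->
    X -> set (valT Y) -> set (valT (X * Y)).

Definition assoc3 (X Y Z : Type) (p : (X * Y) * Z) : X * (Y * Z) :=
  (p.1.1, (p.1.2, p.2)).

(* Main.v *)
From Pilot Require Import Defs.
From mathcomp Require Import all_boot all_order all_algebra.
From mathcomp Require Import boolp classical_sets reals constructive_ereal ereal Rstruct.
From mathcomp Require Import filter.
From mathcomp Require Import lra.
Set Implicit Arguments. Unset Strict Implicit. Unset Printing Implicit Defensive.
Import Order.TTheory GRing.Theory Num.Theory.
Import Pilot.Defs.
Local Open Scope classical_set_scope.
Local Open Scope ring_scope.

(* The strength is [(a, A) |-> P_x V (y |-> (a, y)) (A)], so that naturality and the
   strength axioms are functoriality. What needs work is that it takes values in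
   [P_x V (X * Y)] and is jointly Scott-continuous, which rests on a description of
   directed suprema in [P_x V (Y)].

   The key fact is that finitely many constraints [r_k < mu O_k] satisfied by a
   valuation [mu] are also satisfied by a simple valuation lying below all valuations
   in a whole weak neighbourhood of [mu]. A finite [mu] is split along each [O_k] as
   [mu (U & O_k) + (mu (U | O_k) - mu O_k)], and the pieces are discretized greedily.
   Hence the Scott topology of [V (Y)] is the weak one, closed irreducible sets have a
   top, and [V (Y)] is well-filtered: directed suprema in [P_u V (Y)] are
   intersections, while those in [P_l V (Y)] are closures of unions.

   For [P_b], an ultrafilter on [V (Y)] has a pointwise limit on open sets; when [Y] is
   coherent its regularization is a continuous valuation, and Lawson compactness is
   closedness under these limits. This gives the Lawson compactness of the images, and
   shows that a directed supremum in [P_b V (Y)] is the intersection of the closure of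
   the union of the lower sets with the intersection of the upper sets. *)

(** * Scott topology *)

(** Valuations may take the value [+oo], so splitting by subtraction makes sense only on a part of
    finite measure. A constraint that no such part meets is met through a point whose way-above set
    has infinite measure, and such a point can carry any finite weight.

    The way-below relation of the cone never appears. Its role is played by the condition that a
    whole weak neighbourhood lies above [z]; this combines easily, because lists of constraints
    concatenate.

    In a directed family of pairs [(a, A)] the point and the set move together, so images under one
    fixed map do not suffice. For lower sets, closedness allows the two suprema to be taken one
    after the other. For upper sets, compactness reduces to finitely many pairs, whose first
    components have a common upper bound in the family.

    For [P_b] the order has two halves, and an intersection of a lower and an upper limit could lose
    points needed for either. That it does not is again compactness: a patch-closed set meeting all
    late members of the family meets the limit. *)

Section ListIn.
Variables A B : Type.

Lemma In_cat (x : A) s t : List.In x (s ++ t) <-> List.In x s \/ List.In x t.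
Proof. by elim: s => [|y s IH] /=; tauto. Qed.

Lemma In_map (f : A -> B) y s :
  List.In y (map f s) <-> exists2 x, List.In x s & f x = y.
Proof.
elim: s => [|z s IH] /=; first by split => // -[].
split; first by case=> [<-|/IH[x sx <-]]; [exists z; [left|]|exists x; [right|]].
by case=> x [<-|sx] fx; [left|right; apply/IH; exists x].
Qed.

Lemma In_filter (p : set A) x s :
  List.In x [seq y <- s | `[< p y >]] <-> List.In x s /\ p x.
Proof.
elim: s => [|z s IH] /=; first by tauto.
case: asboolP => pz /=; rewrite ?IH.
  by split; [case=> [<-|[]]|case=> [[<-|]]]; tauto.
by split; [tauto|case=> [[<-|]]; tauto].
Qed.

End ListIn.

Section Order.
Variables (T : Type) (P : set T) (le : T -> T -> Prop).

Lemma scott_closedP (A : set T) : scott_closed P le A <->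
  [/\ A `<=` P, forall x y, A x -> P y -> le y x -> A y &
   forall D s, directed P le D -> is_lub P le D s -> D `<=` A -> A s].
Proof.
split=> [[AP [_ [sat op]]]|[AP dn cl]].
  split=> // [x y Ax Py yx|D s dD lD DA].
    by apply: contrapT => nAy; case: (sat y x (conj Py nAy) (AP _ Ax) yx).
  apply: contrapT => nAs.
  have [d [Dd [_ nAd]]] := op D s dD lD (conj (proj1 lD) nAs).
  exact: nAd (DA _ Dd).
split=> //; split; first by move=> x [].
split=> [x y [Px nAx] Py xy|D s dD lD [Ps nAs]].
  by split=> // Ay; apply: nAx; exact: dn xy.
apply: contrapT => H; apply: nAs; apply: (cl _ _ dD lD) => d Dd.
apply: contrapT => nAd; apply: H; exists d; split=> //; split=> //.
exact: (proj1 dD).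
Qed.

Lemma scott_openC (A : set T) : scott_open P le A -> scott_closed P le (P `\` A).
Proof.
move=> oA; split; first by move=> x [].
suff -> : P `\` (P `\` A) = A by [].
apply/seteqP; split=> [x [Px nx]|x Ax].
  by apply: contrapT => nAx; apply: nx.
by split; [exact: (proj1 oA)|case].
Qed.

Lemma scott_open_meets_directed (D A : set T) (s : T) :
  scott_open P le A -> directed P le D -> is_lub P le D s -> A s ->
  exists d, D d /\ A d.
Proof. by move=> [_ [_ H]]; exact: H. Qed.

Lemma scott_openI U V : 
  scott_open P le U -> scott_open P le V -> scott_open P le (U `&` V).
Proof.
move=> [UP [Us Uo]] [VP [Vs Vo]]; split; first by move=> x [/UP].
split=> [x y [Ux Vx] Py xy|D s dD lD [Us' Vs']].
  by split; [exact: Us xy|exact: Vs xy].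
have [d [Dd Ud]] := Uo _ _ dD lD Us'; have [e [De Ve]] := Vo _ _ dD lD Vs'.
have [DP [_ dd]] := dD; have [z [Dz [dz ez]]] := dd _ _ Dd De.
by exists z; split=> //; split; [exact: (Us _ _ Ud (DP _ Dz) dz)|exact: (Vs _ _ Ve (DP _ Dz) ez)].
Qed.

Lemma scott_open_bigcup (I : Type) (J : set I) (F : I -> set T) :
  (forall i, J i -> scott_open P le (F i)) -> scott_open P le (\bigcup_(i in J) F i).
Proof.
move=> H; split; first by move=> x [i Ji] Fx; exact: (proj1 (H i Ji)).
split=> [x y [i Ji Fx] Py xy|D s dD lD [i Ji Fs]].
  by exists i => //; exact: (proj1 (proj2 (H i Ji)) x y Fx Py xy).
have [d [Dd Fd]] := scott_open_meets_directed (H i Ji) dD lD Fs.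
by exists d; split=> //; exists i.
Qed.

Lemma scott_openU U V :
  scott_open P le U -> scott_open P le V -> scott_open P le (U `|` V).
Proof.
move=> oU oV; have -> : U `|` V = \bigcup_(b in [set: bool]) (if b then U else V).
  apply/seteqP; split=> [x [Ux|Vx]|x [[] _ Hx]];
    [by exists true|by exists false|by left|by right].
by apply: scott_open_bigcup => -[].
Qed.

Lemma scott_open0 : scott_open P le set0.
Proof. by split=> //; split=> // D s _ _ []. Qed.

Lemma scott_openT : scott_open P le P.
Proof.
split=> //; split=> // D s [DP [[d Dd] _]] _ _; exists d; split=> //; exact: DP.
Qed.

Lemma scott_closure_sub A C : scott_closed P le C -> A `<=` C ->
  scott_closure P le A `<=` C.
Proof. by move=> cC AC x [_]; exact. Qed.

Lemma sub_scott_closure A : A `<=` P -> A `<=` scott_closure P le A.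
Proof. by move=> AP x Ax; split=> [|C _]; [exact: AP|exact]. Qed.

Lemma scott_closure_closed A : scott_closed P le (scott_closure P le A).
Proof.
apply/scott_closedP; split; first by move=> x [].
- move=> x y [Px Hx] Py yx; split=> // C cC AC.
  by have /scott_closedP[_ dn _] := cC; apply: dn yx => //; exact: Hx.
- move=> D s dD lD DA; split; first exact: (proj1 lD).
  move=> C cC AC; have /scott_closedP[_ _ cl] := cC; apply: (cl _ _ dD lD) => d Dd.
  by case: (DA d Dd) => _; exact.
Qed.

Lemma scott_closure_mono A B : A `<=` B ->
  scott_closure P le A `<=` scott_closure P le B.
Proof. by move=> AB x [Px H]; split=> // C cC BC; apply: H => // y /AB/BC. Qed.

Lemma scott_closed_closure A : scott_closed P le A -> scott_closure P le A = A.
Proof.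
move=> cA; apply/seteqP; split; first exact: scott_closure_sub.
by apply: sub_scott_closure; case: cA.
Qed.

Lemma scott_closure_meets A x U : A `<=` P ->
  scott_closure P le A x -> scott_open P le U -> U x -> exists a, A a /\ U a.
Proof.
move=> AP [Px H] oU Ux; apply: contrapT => nA.
have : (P `\` U) x by apply: H (scott_openC oU) _ => a Aa;
  split; [exact: AP|move=> Ua; apply: nA; exists a].
by case.
Qed.

End Order.

(** * Continuous valuations *)

Section ExtendedReals.
Local Open Scope ereal_scope.

(** For finite [t], nonnegativity makes all members finite, so each summand can be moved to the
    other side before taking the supremum. *)
Lemma ereal_sup_addle (A B : set (\bar ERreal)) t : A !=set0 -> B !=set0 ->
  (forall a, A a -> 0 <= a) -> (forall b, B b -> 0 <= b) ->
  (forall a b, A a -> B b -> a + b <= t) -> ereal_sup A + ereal_sup B <= t.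
Proof.
move=> [a0 Aa0] [b0 Bb0] A0 B0 H.
have t0 : 0 <= t by apply: le_trans (H _ _ Aa0 Bb0); exact: adde_ge0 (A0 _ Aa0) (B0 _ Bb0).
case: t t0 H => [t||] // t0 H; last by rewrite leey.
have fA a : A a -> a \is a fin_num.
  move=> Aa; rewrite ge0_fin_numE ?A0//; apply: (@le_lt_trans _ _ t%:E); last exact: ltry.
  by apply: le_trans (H _ _ Aa Bb0); rewrite leeDl//; exact: B0.
have sb a : A a -> a + ereal_sup B <= t%:E.
  move=> Aa; rewrite addeC -leeBrDr ?fA//; apply: ge_ereal_sup => b Bb.
  by rewrite leeBrDr ?fA// addeC; exact: H.
have fB : ereal_sup B \is a fin_num.
  rewrite ge0_fin_numE; last by apply: le_trans (B0 _ Bb0) _; exact: ereal_sup_ubound.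
  apply: (@le_lt_trans _ _ t%:E); last exact: ltry.
  by apply: le_trans (sb _ Aa0); rewrite leeDr//; exact: A0.
by rewrite -leeBrDr//; apply: ge_ereal_sup => a Aa; rewrite leeBrDr//; exact: sb.
Qed.

Lemma mem_le_ereal_sup (A : set (\bar ERreal)) x : A x -> x <= ereal_sup A.
Proof. by move=> Ax; exact: ereal_sup_ubound. Qed.

Lemma lee_from_below (a b : \bar ERreal) :
  (forall r : ERreal, r%:E < a -> r%:E <= b) -> a <= b.
Proof.
case: b => [b||] H; last 2 first.
- exact: leey.
- case: a H => [a||] // H; last by have := H 0%R (ltry _).
  by have := H (a - 1)%R; rewrite lte_fin leeNy_eq /= => /(_ ltac:(lra)).
case: a H => [a||] H; last exact: leNye.
- rewrite lee_fin leNgt; apply/negP => ba.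
  move: (H ((a + b) / 2)%R); rewrite lte_fin lee_fin => {H} h.
  have : ((a + b) / 2 <= b)%R by apply: h; lra.
  by move=> {h} ?; lra.
- by move: (H (b + 1)%R (ltry _)); rewrite lee_fin => {H} ?; exfalso; lra.
Qed.

End ExtendedReals.

Section Valuation.
Local Open Scope ereal_scope.
Variables (Y : Type) (le : Y -> Y -> Prop).
Notation op := (sopen le).
Notation C := (is_cval le).
Notation leV := (@le_val Y).

Lemma sopen0 : op set0. Proof. exact: scott_open0. Qed.
Lemma sopenT : op setT. Proof. exact: scott_openT. Qed.
Lemma sopenI U V : op U -> op V -> op (U `&` V). Proof. exact: scott_openI. Qed.
Lemma sopen_bigcup (I : Type) (J : set I) (F : I -> set Y) :
  (forall i, J i -> op (F i)) -> op (\bigcup_(i in J) F i).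
Proof. exact: scott_open_bigcup. Qed.
Lemma sopenU U V : op U -> op V -> op (U `|` V). Proof. exact: scott_openU. Qed.
Lemma sopen_up U x y : op U -> U x -> le x y -> U y.
Proof. by move=> [_ [s _]] Ux xy; exact: (s x y). Qed.

Section Accessors.
Variables (mu : valT Y) (Cmu : C mu).
Lemma cval_out U : ~ op U -> mu U = 0. Proof. by case: Cmu => H _; exact: H. Qed.
Lemma cval_ge0 U : 0 <= mu U. Proof. by case: Cmu => _ [H _]; exact: H. Qed.
Lemma cval0 : mu set0 = 0. Proof. by case: Cmu => _ [_ [H _]]. Qed.
Lemma cval_le U V : op U -> op V -> U `<=` V -> mu U <= mu V.
Proof. by case: Cmu => _ [_ [_ [H _]]]; exact: H. Qed.
Lemma cval_mod U V : op U -> op V -> mu U + mu V = mu (U `|` V) + mu (U `&` V).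
Proof. by case: Cmu => _ [_ [_ [_ [H _]]]]; exact: H. Qed.
Lemma cval_cont (D : set (set Y)) r : (forall U, D U -> op U) -> (exists U, D U) ->
  (forall U V, D U -> D V -> exists W, D W /\ U `<=` W /\ V `<=` W) ->
  r < mu (\bigcup_(U in D) U) -> exists2 U, D U & r < mu U.
Proof.
move=> h1 h2 h3; case: Cmu => _ [_ [_ [_ [_ /(_ D h1 h2 h3) ->]]]].
by case/ereal_sup_gt => _ [U DU <-]; exists U.
Qed.
End Accessors.

(** Only one half of continuity has to be checked; the other follows from monotonicity. *)
Lemma cval_intro (mu : valT Y) :
  (forall U, ~ op U -> mu U = 0) -> (forall U, 0 <= mu U) -> mu set0 = 0 ->
  (forall U V, op U -> op V -> U `<=` V -> mu U <= mu V) ->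
  (forall U V, op U -> op V -> mu U + mu V = mu (U `|` V) + mu (U `&` V)) ->
  (forall D : set (set Y), (forall U, D U -> op U) -> (exists U, D U) ->
     (forall U V, D U -> D V -> exists W, D W /\ U `<=` W /\ V `<=` W) ->
     mu (\bigcup_(U in D) U) <= ereal_sup [set mu U | U in D]) -> C mu.
Proof.
move=> h1 h2 h3 h4 h5 h6; do 5?[split=> //] => D D1 D2 D3.
apply/eqP; rewrite eq_le h6//=; apply: ge_ereal_sup => _ [U DU <-].
apply: h4; [exact: D1|exact: sopen_bigcup|by move=> x Ux; exists U].
Qed.

Lemma le_val_refl mu : leV mu mu. Proof. by []. Qed.
Lemma le_val_trans mu nu xi : leV mu nu -> leV nu xi -> leV mu xi.
Proof. by move=> a b U; exact: le_trans (a U) (b U). Qed.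
Lemma le_val_anti mu nu : leV mu nu -> leV nu mu -> mu = nu.
Proof. by move=> a b; apply/funext => U; apply/eqP; rewrite eq_le a b. Qed.

Definition vsup (D : set (valT Y)) : valT Y := fun U => ereal_sup [set mu U | mu in D].

Lemma vsup_ub D mu : D mu -> leV mu (vsup D).
Proof. by move=> Dmu U; apply: mem_le_ereal_sup; exists mu. Qed.

Lemma vsup_le D nu : (forall mu, D mu -> leV mu nu) -> leV (vsup D) nu.
Proof. by move=> H U; apply: ge_ereal_sup => _ [mu Dmu <-]; exact: H. Qed.

Lemma vsup_add D U V : directed C leV D ->
  vsup D U + vsup D V = ereal_sup [set mu U + mu V | mu in D].
Proof.
move=> [DC [[m0 D0] dir]]; apply/eqP; rewrite eq_le; apply/andP; split.
  apply: ereal_sup_addle; [by exists (m0 U), m0|by exists (m0 V), m0| | |].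
  - by move=> _ [mu /DC/cval_ge0 h <-].
  - by move=> _ [mu /DC/cval_ge0 h <-].
  - move=> _ _ [mu Dmu <-] [nu Dnu <-]; have [xi [Dxi [h1 h2]]] := dir _ _ Dmu Dnu.
    apply: (@le_trans _ _ (xi U + xi V)); first by apply: leeD; [exact: h1|exact: h2].
    by apply: mem_le_ereal_sup; exists xi.
by apply: ge_ereal_sup => _ [mu Dmu <-]; apply: leeD; exact: vsup_ub.
Qed.

(** Modularity survives because sums commute with directed suprema ([vsup_add]), continuity because
    suprema commute with each other. *)
Lemma vsup_cval D : directed C leV D -> C (vsup D).
Proof.
move=> dD; have [DC [[m0 D0] dir]] := dD; apply: cval_intro.
- move=> U nU; apply/eqP; rewrite eq_le; apply/andP; split.
    by apply: ge_ereal_sup => _ [mu /DC Cmu <-]; rewrite (cval_out Cmu).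
  by apply: le_trans (vsup_ub D0 U); exact: cval_ge0 (DC _ D0) U.
- by move=> U; apply: le_trans (vsup_ub D0 U); exact: cval_ge0 (DC _ D0) U.
- apply/eqP; rewrite eq_le; apply/andP; split.
    by apply: ge_ereal_sup => _ [mu /DC Cmu <-]; rewrite (cval0 Cmu).
  by apply: le_trans (vsup_ub D0 _); exact: cval_ge0 (DC _ D0) _.
- move=> U V oU oV UV; apply: ge_ereal_sup => _ [mu Dmu <-].
  by apply: le_trans (vsup_ub Dmu V); apply: (cval_le (DC _ Dmu)).
- move=> U V oU oV; rewrite !vsup_add//; congr ereal_sup; apply/seteqP.
  by split=> _ [mu Dmu <-]; exists mu => //; rewrite (cval_mod (DC _ Dmu) oU oV).
- move=> E E1 E2 E3; apply: ge_ereal_sup => _ [mu Dmu <-].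
  apply: lee_from_below => r /(cval_cont (DC _ Dmu) E1 E2 E3)[U EU rU].
  apply: (@le_trans _ _ (mu U)); first exact: ltW.
  apply: (@le_trans _ _ (vsup D U)); first exact: vsup_ub.
  by apply: mem_le_ereal_sup; exists U.
Qed.

Lemma vsup_lub D : directed C leV D -> is_lub C leV D (vsup D).
Proof.
move=> dD; split; first exact: vsup_cval.
by split=> [d|u _ H]; [exact: vsup_ub|exact: vsup_le].
Qed.

(** Least upper bounds are unique, so directed ones are pointwise. This is what allows
    [scott_closedVP] and [vcont] to speak of [vsup] only. *)
Lemma lub_vsup D s : directed C leV D -> is_lub C leV D s -> s = vsup D.
Proof.
move=> dD [Cs [us ls]]; have [Cv [uv lv]] := vsup_lub dD.
by apply: le_val_anti; [exact: ls|exact: lv].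
Qed.

Lemma scott_closedVP (A : set (valT Y)) : scott_closed C leV A <->
  [/\ A `<=` C, forall x y, A x -> C y -> leV y x -> A y &
   forall D, directed C leV D -> D `<=` A -> A (vsup D)].
Proof.
split=> [/scott_closedP[h1 h2 h3]|[h1 h2 h3]].
  by split=> // D dD; apply: h3 => //; exact: vsup_lub.
apply/scott_closedP; split=> // D s dD lD DA.
by rewrite (lub_vsup dD lD); exact: h3.
Qed.

Lemma cval_zero : C (fun=> 0).
Proof.
apply: cval_intro => // D _ [U DU] _.
by apply: mem_le_ereal_sup; exists U.
Qed.

Lemma cval_add mu nu : C mu -> C nu -> C (fun U => mu U + nu U).
Proof.
move=> Cm Cn; apply: cval_intro.
- by move=> U nU; rewrite !cval_out// adde0.
- by move=> U; rewrite adde_ge0//; exact: cval_ge0.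
- by rewrite !cval0// adde0.
- by move=> U V oU oV UV; apply: leeD; exact: cval_le.
- by move=> U V oU oV; rewrite addeACA (cval_mod Cm oU oV) (cval_mod Cn oU oV) addeACA.
- move=> D D1 D2 D3.
  have [_ [_ [_ [_ [_ /(_ D D1 D2 D3) ->]]]]] := Cm.
  have [_ [_ [_ [_ [_ /(_ D D1 D2 D3) ->]]]]] := Cn.
  have [U0 DU0] := D2.
  apply: ereal_sup_addle; [by exists (mu U0), U0|by exists (nu U0), U0| | |].
  + by move=> _ [U _ <-]; exact: cval_ge0.
  + by move=> _ [U _ <-]; exact: cval_ge0.
  + move=> _ _ [U DU <-] [V DV <-]; have [W [DW [UW VW]]] := D3 _ _ DU DV.
    apply: (@le_trans _ _ (mu W + nu W)); last by apply: mem_le_ereal_sup; exists W.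
    by apply: leeD; apply: cval_le => //; exact: D1.
Qed.

Lemma cval_scale (r : ERreal) mu : (0 <= r)%R -> C mu -> C (fun U => r%:E * mu U).
Proof.
move=> r0 Cm; apply: cval_intro.
- by move=> U nU; rewrite (cval_out Cm)// mule0.
- by move=> U; rewrite mule_ge0 ?lee_fin//; exact: cval_ge0.
- by rewrite (cval0 Cm) mule0.
- by move=> U V oU oV UV; rewrite lee_wpmul2l ?lee_fin//; exact: cval_le.
- move=> U V oU oV; rewrite -!ge0_muleDr; try exact: cval_ge0.
  by rewrite (cval_mod Cm oU oV).
- move=> D D1 D2 D3; have [_ [_ [_ [_ [_ /(_ D D1 D2 D3) ->]]]]] := Cm.
  have [U0 DU0] := D2; rewrite -ereal_supZl//; last by apply/set0P; exists (mu U0), U0.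
  by rewrite image_comp.
Qed.

Lemma vsup_scale (r : ERreal) D : (0 <= r)%R -> D !=set0 ->
  (fun U => r%:E * vsup D U) = vsup [set (fun U => r%:E * mu U) | mu in D].
Proof.
move=> r0 [m Dm]; apply/funext => U; rewrite /vsup -ereal_supZl//; last first.
  by apply/set0P; exists (m U), m.
by rewrite !image_comp.
Qed.

Lemma dirac_in a U : op U -> U a -> dirac le a U = 1.
Proof. by move=> oU Ua; rewrite /dirac asboolT. Qed.

Lemma dirac_notin a U : ~ U a -> dirac le a U = 0.
Proof. by move=> nUa; rewrite /dirac asboolF// => -[]. Qed.

Lemma dirac_cval a : C (dirac le a).
Proof.
have d01 U : 0 <= dirac le a U by rewrite /dirac; case: ifP; rewrite ?lee01.
apply: cval_intro => //.
- by move=> U nU; rewrite /dirac asboolF// => -[].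
- by rewrite dirac_notin.
- move=> U V oU oV UV; have [Ua|Ua] := pselect (U a); last by rewrite dirac_notin.
  by rewrite !dirac_in//; exact: UV.
- move=> U V oU oV; have oUV := sopenU oU oV; have oUV' := sopenI oU oV.
  have [Ua|Ua] := pselect (U a); have [Va|Va] := pselect (V a).
  + by rewrite !dirac_in//; left.
  + by rewrite (dirac_notin Va) (dirac_notin (U := U `&` V)) ?dirac_in//; [left|case].
  + by rewrite (dirac_notin Ua) (dirac_notin (U := U `&` V)) ?dirac_in//; [rewrite addeC|right|case].
  + have nUV : ~ (U `|` V) a by case.
    have nIV : ~ (U `&` V) a by case.
    by rewrite (dirac_notin Ua) (dirac_notin Va) (dirac_notin nUV) (dirac_notin nIV).
- move=> D D1 [U0 DU0] _; have [[U DU Ua]|Ua] := pselect ((\bigcup_(U in D) U) a).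
    rewrite dirac_in; [|exact: sopen_bigcup|by exists U].
    by apply: mem_le_ereal_sup; exists U => //; rewrite dirac_in//; exact: D1.
  rewrite dirac_notin//.
  by apply: le_trans (d01 U0) _; apply: mem_le_ereal_sup; exists U0.
Qed.

Lemma cval_comb (ws : seq (ERreal * valT Y)) :
  (forall p, List.In p ws -> (0 <= p.1)%R /\ C p.2) ->
  C (fun U => \sum_(p <- ws) (p.1)%:E * p.2 U).
Proof.
elim: ws => [|p ws IH] H.
  have -> : (fun U => \sum_(p <- [::]) (p.1)%:E * p.2 U) = (fun=> 0) :> valT Y.
    by apply/funext => U; rewrite big_nil.
  exact: cval_zero.
under eq_fun => U do rewrite big_cons.
apply: cval_add; last by apply: IH => q qs; apply: H; right.
by have [? ?] := H p (or_introl erefl); exact: cval_scale.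
Qed.

Lemma simple_cval s : nonneg_coeffs s -> C (simple le s).
Proof.
move=> s0; have -> : simple le s =
    (fun U => \sum_(q <- [seq (p.1, dirac le p.2) | p <- s]) (q.1)%:E * q.2 U).
  by apply/funext => U; rewrite /simple big_map.
apply: cval_comb => _ /In_map[p ps <-]; split; [exact: s0|exact: dirac_cval].
Qed.

Lemma conv_cval L : (forall mu, List.In mu L -> C mu) -> conv L `<=` C.
Proof.
move=> LC mu [w [sw [w0 [_ ->]]]]; apply: cval_comb => -[r m].
elim: w L {sw} LC w0 => [|v w IH] [|n L] //= LC w0 [[<- <-]|].
  by split; [apply: w0; left|apply: LC; left].
by apply: IH => *; [apply: LC; right|apply: w0; right].
Qed.

End Valuation.

(** * Image valuations and convex sets *)

Section Maps.
Local Open Scope ereal_scope.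
Variables (Y Z : Type) (leY : Y -> Y -> Prop) (leZ : Z -> Z -> Prop).
Notation CY := (is_cval leY).
Notation CZ := (is_cval leZ).
Notation leVY := (@le_val Y).
Notation leVZ := (@le_val Z).

(** [Vmap] sees a map only through preimages of open sets, so this topological form is the
    convenient one. *)
Definition ocont (f : Y -> Z) := forall U, sopen leZ U -> sopen leY (f @^-1` U).

Lemma scott_cont_ocont f : scott_cont setT leY setT leZ f -> ocont f.
Proof.
move=> [_ [mono lub]] U [_ [satU opU]]; split=> //; split.
  by move=> x y Ux _ xy; apply: (satU (f x)) => //; exact: mono.
move=> D s dD lD Us; have [_ [[d0 D0] dir]] := dD.
have dfD : directed setT leZ (f @` D).
  split=> //; split; first by exists (f d0), d0.
  move=> _ _ [x Dx <-] [y Dy <-]; have [z [Dz [xz yz]]] := dir _ _ Dx Dy.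
  by exists (f z); split; [exists z|split; exact: mono].
by have [_ [[d Dd <-] Ud]] := opU _ _ dfD (lub _ _ dD lD) Us; exists d.
Qed.

Definition vcont (h : valT Y -> valT Z) :=
  [/\ forall mu, CY mu -> CZ (h mu),
      forall mu nu, CY mu -> CY nu -> leVY mu nu -> leVZ (h mu) (h nu) &
      forall D, directed CY leVY D -> h (vsup D) = vsup (h @` D)].

Section VCont.
Variables (h : valT Y -> valT Z) (hc : vcont h).

Lemma vcont_directed D : directed CY leVY D -> directed CZ leVZ (h @` D).
Proof.
have [h1 h2 _] := hc; move=> [DC [[d0 D0] dir]]; split.
  by move=> _ [mu Dmu <-]; apply: h1; exact: DC.
split; first by exists (h d0), d0.
move=> _ _ [x Dx <-] [y Dy <-]; have [z [Dz [xz yz]]] := dir _ _ Dx Dy.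
exists (h z); split; first by exists z.
by split; apply: h2 => //; exact: DC.
Qed.

Lemma vcont_closed A : scott_closed CZ leVZ A ->
  scott_closed CY leVY (CY `&` h @^-1` A).
Proof.
have [h1 h2 h3] := hc; move=> /scott_closedVP[AC dn cl].
apply/scott_closedVP; split; first by move=> x [].
- by move=> x y [Cx Ax] Cy yx; split=> //; apply: dn Ax _ _; [exact: h1|exact: h2].
- move=> D dD DA; split; first exact: vsup_cval.
  rewrite /preimage /= h3//; apply: cl; first exact: vcont_directed.
  by move=> _ [mu /DA[_ ?] <-].
Qed.

Lemma vcont_open U : scott_open CZ leVZ U ->
  scott_open CY leVY (CY `&` h @^-1` U).
Proof.
have [h1 _ _] := hc; move=> oU; have := vcont_closed (scott_openC oU).
case=> _; suff -> : CY `\` (CY `&` h @^-1` (CZ `\` U)) = CY `&` h @^-1` U by [].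
apply/seteqP; split=> [mu [Cm nm]|mu [Cm Um]].
  by split=> //; apply: contrapT => nU; apply: nm; split=> //; split=> //; exact: h1.
by split=> // -[_ [_]].
Qed.

Lemma vcont_closure A : A `<=` CY ->
  h @` scott_closure CY leVY A `<=` scott_closure CZ leVZ (h @` A).
Proof.
have [h1 _ _] := hc; move=> AC _ [mu [Cm Hm] <-]; split; first exact: h1.
move=> B cB AB; have [] // := Hm _ (vcont_closed cB) => a Aa.
by split; [exact: AC|apply: AB; exists a].
Qed.

Lemma vcont_compact A : scott_compact CY leVY A ->
  scott_compact CZ leVZ (upset CZ leVZ (h @` A)).
Proof.
have [h1 _ _] := hc; move=> [AC kA]; split; first by move=> x [].
move=> I U oU cov.
have [i|mu Am|s Hs] := kA I (fun i => CY `&` h @^-1` U i).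
- exact: vcont_open.
- have [|i Ui] := cov (h mu); last by exists i; split=> //; exact: AC.
  by split; [apply: h1; exact: AC|exists (h mu); split; [exists mu|]].
- exists s => nu [Cn [_ [[mu Am <-] le]]]; have [i [si [_ Ui]]] := Hs _ Am.
  exists i; split=> //; have [_ [sat _]] := oU i.
  exact: (sat _ _ Ui Cn le).
Qed.

End VCont.

Lemma Vmap_vcont f : ocont f -> vcont (Vmap leZ f).
Proof.
move=> cf; split.
- move=> mu Cm; apply: cval_intro.
  + by move=> U nU; rewrite /Vmap asboolF.
  + by move=> U; rewrite /Vmap; case: asboolP => // _; exact: cval_ge0 Cm _.
  + by rewrite /Vmap; case: asboolP => // _; rewrite preimage_set0 (cval0 Cm).
  + move=> U V oU oV UV; rewrite /Vmap !asboolT//; apply: (cval_le Cm); try exact: cf.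
    by move=> y; exact: UV.
  + move=> U V oU oV; have oUV := sopenU oU oV; have oIV := sopenI oU oV.
    by rewrite /Vmap !asboolT// (cval_mod Cm (cf _ oU) (cf _ oV)).
  + move=> D D1 [U0 DU0] D3; rewrite {1}/Vmap asboolT; last exact: sopen_bigcup.
    apply: lee_from_below => r rlt.
    have E1 V : [set f @^-1` U | U in D] V -> sopen leY V.
      by move=> [U DU <-]; apply: cf; exact: D1.
    have E2 : exists V, [set f @^-1` U | U in D] V by exists (f @^-1` U0), U0.
    have E3 V W : [set f @^-1` U | U in D] V -> [set f @^-1` U | U in D] W ->
        exists X, [set f @^-1` U | U in D] X /\ V `<=` X /\ W `<=` X.
      move=> [U DU <-] [V' DV <-]; have [W' [DW [UW VW]]] := D3 _ _ DU DV.
      by exists (f @^-1` W'); split; [exists W'|split=> y; [exact: UW|exact: VW]].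
    have E : \bigcup_(U in [set f @^-1` U | U in D]) U = f @^-1` (\bigcup_(U in D) U).
      by rewrite bigcup_image preimage_bigcup.
    rewrite -E in rlt; have [_ [U DU <-] rU] := cval_cont Cm E1 E2 E3 rlt.
    apply: (@le_trans _ _ (Vmap leZ f mu U)); last by apply: mem_le_ereal_sup; exists U.
    by rewrite /Vmap asboolT; [exact: ltW|exact: D1].
- by move=> mu nu _ _ le U; rewrite /Vmap; case: asboolP.
- move=> D [_ [[m0 D0] _]]; apply/funext => U; rewrite /Vmap /vsup image_comp /comp.
  case: asboolP => // _; apply/eqP; rewrite eq_le; apply/andP; split.
    by apply: mem_le_ereal_sup; exists m0.
  by apply: ge_ereal_sup => _ [mu _ <-].
Qed.

Lemma Vmap_sum (f : Y -> Z) (ws : seq (ERreal * valT Y)) :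
  Vmap leZ f (fun U => \sum_(p <- ws) (p.1)%:E * p.2 U) =
  (fun U => \sum_(p <- [seq (p.1, Vmap leZ f p.2) | p <- ws]) (p.1)%:E * p.2 U).
Proof.
apply/funext => U; rewrite big_map /= /Vmap; case: asboolP => // _.
by rewrite big1// => p _; rewrite mule0.
Qed.

Lemma Vmap_conv (f : Y -> Z) L : Vmap leZ f @` conv L = conv (map (Vmap leZ f) L).
Proof.
have zm (w : seq ERreal) :
    zip w (map (Vmap leZ f) L) = [seq (p.1, Vmap leZ f p.2) | p <- zip w L].
  by elim: L w => [|m L IH] [|r w] //=; rewrite IH.
apply/seteqP; split.
  move=> _ [_ [w [sw [w0 [w1 ->]]]] <-]; exists w; rewrite size_map.
  by do 3!split=> //; rewrite Vmap_sum zm.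
move=> _ [w [sw [w0 [w1 ->]]]]; rewrite size_map in sw.
exists (fun U => \sum_(p <- zip w L) (p.1)%:E * p.2 U); first by exists w.
by rewrite Vmap_sum zm.
Qed.

Lemma Vmap_convex (f : Y -> Z) A : convex A -> convex (Vmap leZ f @` A).
Proof.
move=> cA _ _ t [mu Am <-] [nu An <-] t01.
exists (fun U => t%:E * mu U + (1 - t)%:E * nu U); first exact: cA.
by apply/funext => U; rewrite /Vmap; case: asboolP => // _; rewrite !mule0 adde0.
Qed.

Lemma Vmap_simple f s : ocont f ->
  Vmap leZ f (simple leY s) = simple leZ [seq (p.1, f p.2) | p <- s].
Proof.
move=> cf; apply/funext => U; rewrite /Vmap /simple big_map.
case: asboolP => oU; last first.
  by rewrite big1// => p _; rewrite /dirac asboolF ?mule0// => -[].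
apply: eq_bigr => p _; congr (_ * _) => /=; have oV := cf _ oU.
have [Up|Up] := pselect (U (f p.2)); first by rewrite !dirac_in.
by rewrite (@dirac_notin _ leY p.2 (f @^-1` U))// (@dirac_notin _ leZ (f p.2) U).
Qed.

End Maps.

Section ConvexSets.
Local Open Scope ereal_scope.
Variables (Y : Type) (le : Y -> Y -> Prop).
Notation C := (is_cval le).
Notation leV := (@le_val Y).

Lemma vcont_affine (t : ERreal) xi : (0 <= t)%R -> C xi ->
  vcont le le (fun mu U => t%:E * mu U + xi U).
Proof.
move=> t0 Cx; split.
- by move=> mu Cm; apply: cval_add => //; exact: cval_scale.
- by move=> mu nu _ _ mn U; rewrite leeD2r// lee_wpmul2l// lee_fin.
- move=> D dD; have [DC [[m0 D0] _]] := dD; apply/funext => U.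
  have D0' : D !=set0 by exists m0.
  have /= -> := congr1 (@^~ U) (vsup_scale t0 D0').
  rewrite /vsup !image_comp /comp -(ereal_sup1 (xi U)).
  apply/eqP; rewrite eq_le; apply/andP; split.
    apply: ereal_sup_addle.
    + by exists (t%:E * m0 U), m0.
    + by exists (xi U).
    + by move=> _ [mu /DC/cval_ge0 h <-]; rewrite mule_ge0// lee_fin.
    + by move=> _ ->; exact: (cval_ge0 Cx).
    + by move=> _ _ [mu Dm <-] ->; apply: mem_le_ereal_sup; exists mu => //; rewrite ereal_sup1.
  apply: ge_ereal_sup => _ [mu Dm <-]; apply: leeD; last by rewrite ereal_sup1.
  by apply: mem_le_ereal_sup; exists mu.
Qed.

(** Separate continuity of the convex combination suffices: the closure is reached in one argument
    while the other stays in [A], then in the other argument. *)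
Lemma scott_closure_convex A : A `<=` C -> convex A -> convex (scott_closure C leV A).
Proof.
move=> AC cA mu nu t Hm Hn /andP[t0 t1].
have t1' : (0 <= 1 - t)%R by rewrite subr_ge0.
have clC x : scott_closure C leV A x -> C x by case.
have step1 xi : A xi -> forall x, scott_closure C leV A x ->
    scott_closure C leV A (fun U => t%:E * x U + (1 - t)%:E * xi U).
  move=> Ax x Hx.
  have cx := vcont_affine t0 (cval_scale t1' (AC _ Ax)).
  have [] // := scott_closure_sub (vcont_closed cx (scott_closure_closed C leV A)) _ Hx.
  move=> y Ay; split; first exact: AC.
  by apply: sub_scott_closure => //; apply: cA => //; rewrite t0.
(* Second pass: [mu] is now a fixed point of the closure and the other argument runs over [A], where
   [step1] applies. *)
have cx := vcont_affine t1' (cval_scale t0 (clC _ Hm)).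
under eq_fun => U do rewrite addeC.
have [] // := scott_closure_sub (vcont_closed cx (scott_closure_closed C leV A)) _ Hn.
move=> y Ay; split; first exact: AC.
by rewrite /preimage /=; under eq_fun => U do rewrite addeC; exact: step1.
Qed.

Lemma upset_convex A : A `<=` C -> convex A -> convex (upset C leV A).
Proof.
move=> AC cA mu nu t [Cm [x [Ax xm]]] [Cn [y [Ay yn]]] t01; have /andP[t0 t1] := t01.
have t1' : (0 <= 1 - t)%R by rewrite subr_ge0.
split; first by apply: cval_add; exact: cval_scale.
exists (fun U => t%:E * x U + (1 - t)%:E * y U); split; first exact: cA.
by move=> U; apply: leeD; rewrite lee_wpmul2l ?lee_fin.
Qed.

Lemma downset_convex A : A `<=` C -> convex A -> convex (downset C leV A).
Proof.
move=> AC cA mu nu t [Cm [x [Ax xm]]] [Cn [y [Ay yn]]] t01; have /andP[t0 t1] := t01.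
have t1' : (0 <= 1 - t)%R by rewrite subr_ge0.
split; first by apply: cval_add; exact: cval_scale.
exists (fun U => t%:E * x U + (1 - t)%:E * y U); split; first exact: cA.
by move=> U; apply: leeD; rewrite lee_wpmul2l ?lee_fin.
Qed.

Lemma upset_saturated A : saturated C leV (upset C leV A).
Proof.
by move=> x y [Cx [z [Az zx]]] Cy xy; split=> //; exists z; split=> //; exact: le_val_trans zx xy.
Qed.

Lemma upset_id A : A `<=` C -> saturated C leV A -> upset C leV A = A.
Proof.
move=> AC sA; apply/seteqP; split=> [y [Cy [x [Ax xy]]]|x Ax]; first exact: (sA x).
by split; [exact: AC|exists x; split=> //; exact: le_val_refl].
Qed.

Lemma downset_id A : scott_closed C leV A -> downset C leV A = A.
Proof.
move=> /scott_closedVP[AC dn _]; apply/seteqP; split=> [y [Cy [x [Ax xy]]]|x Ax].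
  exact: (dn x).
by split; [exact: AC|exists x; split=> //; exact: le_val_refl].
Qed.

End ConvexSets.

Lemma Vmap_comp (X Y Z : Type) (leY : Y -> Y -> Prop) (leZ : Z -> Z -> Prop)
    (f : X -> Y) (g : Y -> Z) mu : ocont leY leZ g ->
  Vmap leZ g (Vmap leY f mu) = Vmap leZ (g \o f) mu.
Proof.
move=> cg; apply/funext => U; rewrite /Vmap; case: asboolP => // oU.
by rewrite asboolT//; exact: cg.
Qed.

Lemma Vmap_id (X : Type) (le : X -> X -> Prop) mu : is_cval le mu -> Vmap le id mu = mu.
Proof.
move=> Cm; apply/funext => U; rewrite /Vmap; case: asboolP => // nU.
by rewrite (cval_out Cm).
Qed.

(** * Way-below relation and weights *)

Section Domain.
Variables (Y : Type) (le : Y -> Y -> Prop) (domY : is_domain le).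
Notation op := (sopen le).
Notation C := (is_cval le).
Notation leV := (@le_val Y).
Notation wb := (way_below le).

Lemma dom_refl x : le x x. Proof. by case: domY => [[[h _] _] _]. Qed.
Lemma dom_trans x y z : le x y -> le y z -> le x z.
Proof. by case: domY => [[[_ [h _]] _] _]; exact: h. Qed.

Lemma wb_le x y : wb x y -> le x y.
Proof.
move=> H; have [||//|d [-> //]] := H [set y] y; last exact: dom_refl.
- split=> //; split; first by exists y.
  by move=> _ _ -> ->; exists y; split=> //; split; exact: dom_refl.
- split=> //; split=> [_ ->|u _]; first exact: dom_refl.
  exact.
Qed.

Lemma le_wb x' x y y' : le x' x -> wb x y -> le y y' -> wb x' y'.
Proof.
move=> xx xy yy D s dD lD ys.
have [d [Dd xd]] := xy _ _ dD lD (dom_trans yy ys).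
by exists d; split=> //; exact: dom_trans xd.
Qed.

Lemma wb_directed y : directed setT le (fun x => wb x y).
Proof. by case: domY => _ /(_ y)[]. Qed.

Lemma wb_lub y : is_lub setT le (fun x => wb x y) y.
Proof. by case: domY => _ /(_ y)[]. Qed.

(** The points that lie two way-below steps under [y] form a directed set with supremum [y], so [x]
    is below one of them. *)
Lemma wb_interp x y : wb x y -> exists2 z, wb x z & wb z y.
Proof.
move=> xy; pose D := [set z | exists2 z', wb z z' & wb z' y].
have [_ [[y0 y0y] diry]] := wb_directed y.
have dD : directed setT le D.
  split=> //; split.
    have [_ [[w wy0] _]] := wb_directed y0.
    by exists w, y0.
  move=> a b [a' aa' ay] [b' bb' bw]; have [z' [z'y [az bz]]] := diry _ _ ay bw.
  have [_ [_ dirz]] := wb_directed z'.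
  have [z [zz' [? ?]]] := dirz a b (le_wb (dom_refl _) aa' az) (le_wb (dom_refl _) bb' bz).
  by exists z; split=> //; exists z'.
have lD : is_lub setT le D y.
  split=> //; split=> [z [z' zz' z'y]|u _ ub]; first exact: dom_trans (wb_le zz') (wb_le z'y).
  have [_ [_ ly]] := wb_lub y; apply: ly => // z' z'y.
  have [_ [_ lz]] := wb_lub z'; apply: lz => // z zz'.
  by apply: ub; exists z'.
have [d [[d' dd' d'y] xd]] := xy _ _ dD lD (dom_refl y).
by exists d' => //; exact: le_wb xd dd' (dom_refl _).
Qed.

(** The way-above set of [Q], often written with a double arrow; it is open by interpolation. *)
Definition up (Q : set Y) : set Y := fun y => exists2 x, Q x & wb x y.

Lemma up_open Q : op (up Q).
Proof.
split=> //; split.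
  by move=> x y [q Qq qx] _ xy; exists q => //; exact: le_wb (dom_refl _) qx xy.
move=> D s dD lD [q Qq qs]; have [z qz zs] := wb_interp qs.
have [d [Dd zd]] := zs _ _ dD lD (dom_refl _).
by exists d; split=> //; exists q => //; exact: le_wb (dom_refl _) qz zd.
Qed.

Lemma up_sub U Q : op U -> Q `<=` U -> up Q `<=` U.
Proof. by move=> oU QU y [x /QU Ux /wb_le xy]; exact: sopen_up Ux xy. Qed.

Lemma up_mono Q Q' : Q `<=` Q' -> up Q `<=` up Q'.
Proof. by move=> QQ y [x Qx xy]; exists x => //; exact: QQ. Qed.

Lemma up_setU Q Q' : up (Q `|` Q') = up Q `|` up Q'.
Proof.
apply/seteqP; split=> [y [x [Qx|Qx] xy]|y [[x Qx xy]|[x Qx xy]]].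
- by left; exists x.
- by right; exists x.
- by exists x => //; left.
- by exists x => //; right.
Qed.

Lemma up_point U y : op U -> U y -> exists2 x, U x & wb x y.
Proof.
move=> oU Uy; have [x [xy Ux]] := scott_open_meets_directed oU (wb_directed y) (wb_lub y) Uy.
by exists x.
Qed.

Definition pts (F : seq Y) : set Y := fun x => List.In x F.

Lemma pts_cons x F : pts (x :: F) = [set x] `|` pts F.
Proof. by apply/seteqP; split=> y [->|?]; [left|right|left|right]. Qed.

Lemma open_bigcup_up U : op U ->
  U = \bigcup_(V in [set up (pts F) | F in [set F | pts F `<=` U]]) V.
Proof.
move=> oU; apply/seteqP; split=> [y Uy|y [_ [F FU <-]]]; last exact: up_sub.
have [x Ux xy] := up_point oU Uy.
exists (up (pts [:: x])); last by exists x => //; left.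
by exists [:: x] => // z [<-|[]].
Qed.

(** The sets [up (pts F)] with [F] a finite part of [U] are directed with union [U], so continuity
    of [mu] becomes inner regularity. *)
Lemma cval_approx mu U r : C mu -> op U -> (r < mu U)%E ->
  exists2 F, pts F `<=` U & (r < mu (up (pts F)))%E.
Proof.
move=> Cm oU; rewrite [X in mu X](open_bigcup_up oU) => H.
have [|||_ [F FU <-] rF] := cval_cont Cm _ _ _ H; last by exists F.
- by move=> _ [F FU <-]; exact: up_open.
- by exists (up (pts [::])), [::].
- move=> _ _ [F FU <-] [G GU <-]; exists (up (pts (F ++ G))); split.
    by exists (F ++ G) => // x /In_cat[/FU|/GU].
  by split; apply: up_mono => x Fx; apply/In_cat; [left|right].
Qed.

(** * Weights of finite combinations of points *)

Section Weights.

Definition wt (s : seq (ERreal * Y)) (Q : set Y) : ERreal := \sum_(p <- s | `[< Q p.2 >]) p.1.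

Lemma wt_cons p s Q : wt (p :: s) Q = (if `[< Q p.2 >] then p.1 else 0) + wt s Q.
Proof. by rewrite /wt big_cons; case: ifP => // _; rewrite add0r. Qed.

Lemma wt_cat s t Q : wt (s ++ t) Q = wt s Q + wt t Q.
Proof. by rewrite /wt big_cat. Qed.

Lemma nonneg_cons p (s : seq (ERreal * Y)) : nonneg_coeffs (p :: s) -> 0 <= p.1 /\ nonneg_coeffs s.
Proof. by move=> H; split; [apply: H; left|move=> q qs; apply: H; right]. Qed.

Lemma wt_mono (s : seq (ERreal * Y)) Q Q' : nonneg_coeffs s ->
  (forall p, List.In p s -> Q p.2 -> Q' p.2) -> wt s Q <= wt s Q'.
Proof.
elim: s => [|p s IH] s0 H; first by rewrite /wt !big_nil.
have [p0 s1] := nonneg_cons s0; rewrite !wt_cons; apply: lerD; last first.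
  by apply: IH => // q qs; apply: H; right.
case: asboolP => Qp; case: asboolP => // Qp'.
by case: Qp'; apply: H => //; left.
Qed.

Lemma wt_ge0 (s : seq (ERreal * Y)) Q : nonneg_coeffs s -> 0 <= wt s Q.
Proof.
elim: s => [|p s IH] s0; first by rewrite /wt !big_nil.
have [p0 s1] := nonneg_cons s0; rewrite wt_cons addr_ge0 ?IH//.
by case: ifP.
Qed.

Lemma wt_mem (s : seq (ERreal * Y)) Q p : nonneg_coeffs s -> List.In p s -> Q p.2 -> p.1 <= wt s Q.
Proof.
elim: s => // q s IH /nonneg_cons[q0 s0] /= [->|ps] Qp; rewrite wt_cons.
  by rewrite asboolT// lerDl wt_ge0.
by apply: le_trans (IH s0 ps Qp) _; rewrite lerDr; case: ifP.
Qed.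

Lemma wt0 s Q : (forall p, List.In p s -> ~ Q p.2) -> wt s Q = 0.
Proof.
elim: s => [|p s IH] H; first by rewrite /wt big_nil.
rewrite wt_cons asboolF ?IH ?addr0//; last by apply: H; left.
by move=> q qs; apply: H; right.
Qed.

Lemma wt_scale (c : ERreal) s Q : wt [seq (c * p.1, p.2) | p <- s] Q = c * wt s Q.
Proof. by rewrite /wt big_map mulr_sumr. Qed.

Lemma simple_wt s U : op U -> simple le s U = (wt s U)%:E.
Proof.
move=> oU; rewrite /simple; elim: s => [|p s IH]; first by rewrite /wt !big_nil.
rewrite wt_cons big_cons IH EFinD; congr (_ + _)%E; case: asboolP => Up.
  by rewrite dirac_in// mule1.
by rewrite dirac_notin// mule0.
Qed.

End Weights.

(** Finite valuations. Real values permit subtraction, and continuity is kept in the form of inner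
    regularity, which is stable under restriction and quotient. *)
Record rval (m : set Y -> ERreal) : Prop := RVal {
  rval_le : forall U V, op U -> op V -> U `<=` V -> m U <= m V;
  rval0 : m set0 = 0;
  rval_mod : forall U V, op U -> op V -> m U + m V = m (U `|` V) + m (U `&` V);
  rval_inner : forall U e, op U -> 0 < e ->
    exists2 F, pts F `<=` U & m U - e < m (up (pts F)) }.

Lemma rval_restr m O : op O -> rval m -> rval (fun U => m (U `&` O)).
Proof.
move=> oO [h1 h2 h3 h4]; split.
- by move=> U V oU oV UV; apply: h1; try exact: sopenI; exact: setSI.
- by rewrite set0I.
- move=> U V oU oV; rewrite h3; try exact: sopenI.
  by rewrite -setIUl setIACA setIid.
- move=> U e oU e0; have [F FU H] := h4 _ _ (sopenI oU oO) e0.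
  exists F; first by move=> x /FU[].
  suff -> : up (pts F) `&` O = up (pts F) by [].
  apply/setIidl; apply: up_sub => //.
  by move=> x /FU[].
Qed.

(** This is the mass of [U] outside [O], written with open sets only. *)
Lemma rval_quot m O : op O -> rval m -> rval (fun U => m (U `|` O) - m O).
Proof.
move=> oO [h1 h2 h3 h4]; split.
- by move=> U V oU oV UV; rewrite lerB// h1//; try exact: sopenU; exact: setSU.
- by rewrite set0U subrr.
- move=> U V oU oV; have := h3 _ _ (sopenU oU oO) (sopenU oV oO).
  by rewrite setUACA setUid -setUIl; lra.
- move=> U e oU e0; have [F FU H] := h4 _ _ (sopenU oU oO) e0.
  exists [seq x <- F | `[< U x >]]; first by move=> x /In_filter[].
  have -> : m (U `|` O) - m O - e = m (U `|` O) - e - m O by lra.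
  rewrite ltrD2r; apply: lt_le_trans H _; apply: h1; first exact: up_open.
    by apply: sopenU => //; exact: up_open.
  move=> y [x Fx xy]; have [Ux|Ox] := FU _ Fx.
    by left; exists x => //; apply/In_filter.
  by right; exact: sopen_up Ox (wb_le xy).
Qed.

(** A Hall-type condition. Only the points of [Q] that occur in [s] matter on the left, so it
    amounts to finitely many inequalities on open sets [up Q]. *)
Definition below (s : seq (ERreal * Y)) (m : set Y -> ERreal) :=
  forall Q, wt s Q <= m (up Q).

(** The first point [x] receives all the mass of [up [set x]]; the remaining points are served from
    the quotient by that open set. The total telescopes to [m (up (pts F))]. *)
Lemma rval_greedy F m : rval m ->
  exists s, [/\ nonneg_coeffs s, forall p, List.In p s -> List.In p.2 F,
    below s m & wt s setT = m (up (pts F))].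
Proof.
elim: F m => [|x F IH] m rm.
  exists [::]; split=> //.
    move=> Q; rewrite /wt big_nil -(rval0 rm); apply: (rval_le rm) => //.
      exact: sopen0.
    exact: up_open.
  rewrite /wt big_nil -(rval0 rm); congr m; apply/seteqP.
  by split=> // y [].
have oO := up_open [set x]; set O := up [set x] in oO *.
have m_ge0 U : op U -> 0 <= m U.
  by move=> oU; rewrite -(rval0 rm); apply: (rval_le rm) => //; exact: sopen0.
have [s [s0 sF sb st]] := IH _ (rval_quot oO rm).
exists ((m O, x) :: s); split.
- by move=> p [<-|/s0 //]; exact: m_ge0.
- by move=> p [<-|/sF]; [left|right].
- move=> Q; rewrite wt_cons /=; have := sb Q; case: asboolP => Qx H.
    have E : up Q `|` O = up Q.
      by apply/setUidl; apply: up_mono => _ ->.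
    by rewrite E in H; lra.
  (* If [x] is not in [Q], the bound from the quotient is the mass of [up Q] outside [O], which
     modularity compares with [m (up Q)]. *)
  have := rval_mod rm (up_open Q) oO.
  have := m_ge0 _ (sopenI (up_open Q) oO); lra.
- rewrite wt_cons asboolT//= st pts_cons up_setU setUC; lra.
Qed.

(** Induction on the constraints: [m] is the sum of its restriction to [O] and its quotient by [O],
    each approximated up to [e / 2]. Carrying the support [D] along ensures that the first half
    lives inside [O], so all its weight counts there. *)
Lemma rval_approx l m D e : rval m -> op D -> 0 < e ->
  (forall O, List.In O l -> op O) ->
  exists s, [/\ nonneg_coeffs s, forall p, List.In p s -> D p.2, below s m,
    m D - e < wt s setT & forall O, List.In O l -> m (O `&` D) - e < wt s O].
Proof.
elim: l m D e => [|O l IH] m D e rm oD e0 ol.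
  have [F FD FU] := rval_inner rm oD e0.
  have [s [s0 sF sb st]] := rval_greedy F rm.
  exists s; split=> //; last by rewrite st.
  by move=> p /sF /FD.
have oO : op O by apply: ol; left.
have ol' O' : List.In O' l -> op O' by move=> ?; apply: ol; right.
have e2 : 0 < e / 2 by lra.
have [s1 [s10 s1D s1b s1t s1l]] := IH _ _ _ (rval_restr oO rm) (sopenI oD oO) e2 ol'.
have [s2 [s20 s2D s2b s2t s2l]] := IH _ _ _ (rval_quot oO rm) oD e2 ol'.
exists (s1 ++ s2); split.
- by move=> p /In_cat[/s10|/s20].
- by move=> p /In_cat[/s1D[]|/s2D].
- move=> Q; rewrite wt_cat; have := s1b Q; have := s2b Q.
  have := rval_mod rm (up_open Q) oO; lra.
- rewrite wt_cat; move: s1t s2t; rewrite -setIA setIid.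
  have := rval_mod rm oD oO; lra.
- move=> O' [<-|lO'].
    rewrite wt_cat; move: s1t; rewrite -setIA setIid [O `&` D]setIC.
    have -> : wt s1 setT = wt s1 O.
      apply/eqP; rewrite eq_le !wt_mono// => p /s1D[//].
    have := wt_ge0 O s20; lra.
  (* For a later constraint both halves contribute, and modularity of [O' & D] against [O] adds them
     up. *)
  rewrite wt_cat; move: (s1l _ lO') (s2l _ lO').
  have := rval_mod rm (sopenI (ol' _ lO') oD) oO.
  by rewrite setIA -[_ `&` O `&` O]setIA setIid; lra.
Qed.

End Domain.

(** * Approximation by simple valuations *)

Section ListBounds.
Variables (A : Type) (f : A -> ERreal).

Lemma list_lower_bound l : (forall p, List.In p l -> 0 < f p) ->
  exists e, [/\ 0 < e, e <= 1 & forall p, List.In p l -> e <= f p].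
Proof.
elim: l => [|p l IH] H; first by exists 1; split.
have [q ql|e [e0 e1 el]] := IH; first by apply: H; right.
have fp : 0 < f p by apply: H; left.
exists (Num.min e (f p)); split; first by rewrite lt_min e0.
  by rewrite ge_min e1.
by move=> q [<-|ql]; rewrite ge_min ?lexx ?orbT// el.
Qed.

Lemma list_upper_bound l : exists2 B, 0 <= B & forall p, List.In p l -> f p <= B.
Proof.
elim: l => [|p l [B B0 IH]]; first by exists 0.
exists (Num.max B (f p)); first by rewrite le_max B0.
by move=> q [<-|ql]; rewrite le_max ?lexx ?orbT// IH.
Qed.

End ListBounds.

Section Sublists.
Variable A : Type.

Fixpoint sublists (l : seq A) : seq (seq A) :=
  if l is x :: l' then sublists l' ++ map (cons x) (sublists l') else [:: [::]].

(** Turns a condition on all subsets, such as [below], into one on finitely many lists. *)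
Lemma sublists_set l (Q : set A) :
  exists2 t, List.In t (sublists l) & forall x, List.In x t <-> List.In x l /\ Q x.
Proof.
elim: l => [|x l [t tl H]] /=; first by exists [::]; [left|move=> x; split=> // -[]].
have [Qx|nQx] := pselect (Q x); [exists (x :: t)|exists t].
- by apply/In_cat; right; apply/In_map; exists t.
- move=> y; split=> /=; first by case=> [<-|/H[]]; tauto.
  by case=> -[->|yl] Qy; [left|right; apply/H].
- by apply/In_cat; left.
- move=> y; split; first by move=> /H[]; tauto.
  by case=> -[<-|yl] Qy //; apply/H.
Qed.

End Sublists.

(** * Weak neighbourhoods of valuations *)

Section WeakNeighbourhoods.
Variables (Y : Type) (le : Y -> Y -> Prop).
Notation op := (sopen le).
Notation C := (is_cval le).
Notation leV := (@le_val Y).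

Definition open_list (l : seq (set Y * ERreal)) := forall p, List.In p l -> op p.1.

Definition weak_nbhd (l : seq (set Y * ERreal)) : set (valT Y) :=
  fun mu => C mu /\ forall p, List.In p l -> (p.2%:E < mu p.1)%E.

Lemma weak_nbhd_open l : open_list l -> scott_open C leV (weak_nbhd l).
Proof.
elim: l => [|p l IH] ol.
  have -> : weak_nbhd [::] = C by apply/seteqP; split=> [mu []|].
  exact: scott_openT.
have -> : weak_nbhd (p :: l) = weak_nbhd [:: p] `&` weak_nbhd l.
  apply/seteqP; split=> [mu [Cm H]|mu [[Cm H1] [_ H2]]].
    by split; split=> // q; [case=> [<-|[]]|move=> ql]; apply: H; [left|right].
  by split=> // q [<-|/H2 //]; apply: H1; left.
apply: scott_openI; last by apply: IH => q ql; apply: ol; right.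
split; first by move=> mu [].
split.
  move=> mu nu [_ H] Cn mn; split=> // q [<-|[]].
  by apply: lt_le_trans (mn _); apply: H; left.
move=> D s dD lD [_ /(_ p)]; rewrite (lub_vsup dD lD) => H.
have /ereal_sup_gt[_ [mu Dm <-] mp] := H (or_introl erefl).
exists mu; split=> //; split; first by case: dD => DC _; exact: DC.
by move=> q [<-|[]].
Qed.

Lemma weak_nbhd_cat l l' : weak_nbhd (l ++ l') = weak_nbhd l `&` weak_nbhd l'.
Proof.
apply/seteqP; split=> [mu [Cm H]|mu [[Cm H1] [_ H2]]].
  by split; split=> // q ql; apply: H; apply/In_cat; [left|right].
by split=> // q /In_cat[/H1|/H2].
Qed.

Lemma open_list_cat l l' : open_list l -> open_list l' -> open_list (l ++ l').
Proof. by move=> a b p /In_cat[/a|/b]. Qed.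

End WeakNeighbourhoods.

Section Approximation.
Variables (Y : Type) (le : Y -> Y -> Prop) (domY : is_domain le).
Notation op := (sopen le).
Notation C := (is_cval le).
Notation leV := (@le_val Y).
Notation wb := (way_below le).
Notation up := (up le).

Section Fixed.
Variables (mu : valT Y) (Cm : C mu).

(** A weight put on such a point never violates a bound of the form [wt s Q <= mu (up Q)]. *)
Definition infinite_point x := forall Q : set Y, Q x -> mu (up Q) = +oo%E.

(* If no open part of [O] of finite measure suffices, there is a largest one; every
   open set containing a point of [O] outside of it has infinite measure. *)
Lemma finite_part_or_infinite_point O r : op O -> (r%:E < mu O)%E ->
  (exists U, [/\ op U, U `<=` O, (mu U < +oo)%E & (r%:E < mu U)%E]) \/
  (exists2 x, O x & infinite_point x).
Proof.
move=> oO rO; apply: contrapT => /not_orP[nU nx].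
pose D := [set U | [/\ op U, U `<=` O & (mu U < +oo)%E]].
have D1 U : D U -> op U by case.
have D0 : D set0 by split; [exact: sopen0|exact: sub0set|rewrite (cval0 Cm)].
have Dfin U V : D U -> D V -> D (U `|` V).
  move=> [oU UO fU] [oV VO fV]; split; [exact: sopenU|by rewrite subUset|].
  apply: (@le_lt_trans _ _ (mu U + mu V)%E); last by rewrite lte_add_pinfty.
  by rewrite (cval_mod Cm)// leeDl//; exact: cval_ge0 Cm _.
have D3 U V : D U -> D V -> exists W, D W /\ U `<=` W /\ V `<=` W.
  by move=> DU DV; exists (U `|` V); split; [exact: Dfin|split=> x; [left|right]].
apply: nx; have [OW|] := pselect (O `<=` \bigcup_(U in D) U).
  have E : O = \bigcup_(U in D) U by apply/seteqP; split=> // x [U [_ UO _]]; exact: UO.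
  rewrite {}E in rO; have [U [oU UO fU] rU] := cval_cont Cm D1 (ex_intro _ _ D0) D3 rO.
  by case: nU; exists U.
move=> /existsNP[x /not_implyP[Ox nWx]].
(* Moving down to [x'] makes [up Q] a neighbourhood of [x] as soon as [Q] contains [x']. *)
have [x' Ox' x'x] := up_point domY oO Ox; exists x' => // Q Qx'.
have oQ := up_open domY Q.
apply/eqP; rewrite -leye_eq leNgt; apply/negP => fQ; apply: nWx.
exists (up Q `&` O); last by split=> //; exists x'.
split; [exact: sopenI|by move=> ? []|].
by apply: le_lt_trans fQ; apply: (cval_le Cm (sopenI oQ oO) oQ); exact: subIsetl.
Qed.

(** Finite parts can be united, so one [U] serves all constraints of the first kind, and the list
    [T] holds a witness for each of the others. *)
Lemma finite_part_list l : open_list le l -> weak_nbhd le l mu ->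
  exists U T, [/\ op U, (mu U < +oo)%E, forall x, List.In x T -> infinite_point x &
    forall p, List.In p l -> (p.2%:E < mu (p.1 `&` U))%E \/ exists2 x, List.In x T & p.1 x].
Proof.
elim: l => [|p l IH] ol [_ H].
  by exists set0, [::]; split=> //; [exact: sopen0|rewrite (cval0 Cm)].
have ol' : open_list le l by move=> q ql; apply: ol; right.
have lmu : weak_nbhd le l mu by split=> // q ql; apply: H; right.
have [U [T [oU fU iT UT]]] := IH ol' lmu.
have op1 : op p.1 by apply: ol; left.
have [[V [oV VO fV pV]]|[x px ix]] :=
    finite_part_or_infinite_point op1 (H p (or_introl erefl)).
  exists (U `|` V), T; split=> //; first exact: sopenU.
    apply: (@le_lt_trans _ _ (mu U + mu V)%E); last by rewrite lte_add_pinfty.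
    by rewrite (cval_mod Cm)// leeDl//; exact: cval_ge0 Cm _.
  have oUV := sopenU oU oV.
  move=> q [<-|ql]; [left|have [h|] := UT _ ql; [left|by right]].
    apply: lt_le_trans pV _; apply: (cval_le Cm) => //; first exact: sopenI.
    by move=> y Vy; split; [exact: VO|right].
  have oq : op q.1 by apply: ol; right.
  apply: lt_le_trans h _; apply: (cval_le Cm); try exact: sopenI.
  by move=> y [? ?]; split=> //; left.
exists U, (x :: T); split=> //; first by move=> y [<-|/iT].
move=> q [<-|ql]; first by right; exists x => //; left.
by have [h|[y yT qy]] := UT _ ql; [left|right; exists y => //; right].
Qed.

Lemma cval_fin_restr U V : op U -> (mu U < +oo)%E -> op V ->
  mu (V `&` U) = (fine (mu (V `&` U)))%:E.
Proof.
move=> oU fU oV; rewrite fineK// ge0_fin_numE; last exact: cval_ge0 Cm _.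
by apply: le_lt_trans fU; apply: (cval_le Cm (sopenI oV oU) oU); exact: subIsetr.
Qed.

Lemma cval_rval U : op U -> (mu U < +oo)%E -> rval le (fun V => fine (mu (V `&` U))).
Proof.
move=> oU fU; have fE := cval_fin_restr oU fU; split.
- move=> V W oV oW VW; rewrite -lee_fin -!fE//.
  by apply: (cval_le Cm); try exact: sopenI; exact: setSI.
- by rewrite set0I (cval0 Cm).
- move=> V W oV oW; apply: EFin_inj.
  rewrite !EFinD -!fE//; [|exact: sopenI|exact: sopenU].
  by rewrite (cval_mod Cm); try exact: sopenI; rewrite -setIUl setIACA setIid.
- move=> V e oV e0.
  have [|F FU H] := cval_approx domY Cm (sopenI oV oU) (r := (fine (mu (V `&` U)) - e)%:E).
    by rewrite [ltRHS]fE// lte_fin; lra.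
  exists F; first by move=> x /FU[].
  have FE : up (pts F) `&` U = up (pts F).
    by apply/setIidl; apply: up_sub => // x /FU[].
  by rewrite -lte_fin -fE ?FE//; exact: up_open.
Qed.

End Fixed.

(** The simple valuation is a discretization of [mu] on the finite part, plus large weights at the
    infinite points, all scaled by [c < 1]. The scaling makes the Hall-type bounds strict at [mu],
    so they define a weak neighbourhood of [mu], and they suffice to put [z] below any [nu] in
    it. *)
Lemma approximation mu l : C mu -> open_list le l -> weak_nbhd le l mu ->
  exists z l', [/\ weak_nbhd le l z, open_list le l', weak_nbhd le l' mu &
    forall nu, weak_nbhd le l' nu -> leV z nu].
Proof.
move=> Cm ol lmu; have [U [T [oU fU iT UT]]] := finite_part_list Cm ol lmu.
have fE V : op V -> _ := cval_fin_restr Cm oU fU (V := V).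
have rm := cval_rval Cm oU fU; set m := (fun V => fine (mu (V `&` U))) in rm.
(* The least slack among the constraints met on [U]; for those met through [T] the default 1 only
   has to be positive. *)
have [] := @list_lower_bound _
    (fun p => if `[< (p.2%:E < mu (p.1 `&` U))%E >] then m p.1 - p.2 else 1) l.
  move=> p pl; case: asboolP => // h.
  by rewrite subr_gt0 -lte_fin -fE//; exact: ol.
(* The slack has to pay twice: less than [e] is lost by discretizing and less than [e] by
   scaling. *)
move=> e3 [e3_gt0 e3_le1 e3l]; pose e := e3 / 3.
have e0 : 0 < e by rewrite /e; lra.
have e1 : e <= 1 by rewrite /e; lra.
have [B B0 BP] := list_upper_bound (fun p : set Y * ERreal => p.2) l.
have [s0 [s00 _ s0b _ s0l]] := rval_approx domY rm (sopenT le) e0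
  (l := map fst l) ltac:(by move=> _ /In_map[p pl <-]; exact: ol).
(* Since [B] bounds the thresholds and [e <= 1], a single weight [B + 2] exceeds every threshold by
   more than [e]. *)
pose s := s0 ++ [seq (B + 2, x) | x <- T].
have sT p : List.In p [seq (B + 2, x) | x <- T] -> List.In p.2 T /\ p.1 = B + 2.
  by move=> /In_map[x xT <-].
have sn : nonneg_coeffs s by move=> p /In_cat[/s00//|/sT[_ ->]]; lra.
have sb Q : ((wt s Q)%:E <= mu (up Q))%E.
  (* If [Q] contains a point of [T] the right-hand side is infinite; otherwise only [s0] has weight
     in [Q]. *)
  have [[x xT Qx]|nQ] := pselect (exists2 x, List.In x T & Q x).
    by rewrite (iT _ xT _ Qx) leey.
  rewrite /s wt_cat [X in _ + X]wt0 ?addr0; last first.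
    by move=> p /sT[pT _] Qp; apply: nQ; exists p.2.
  apply: (@le_trans _ _ (m (up Q))%:E); first by rewrite lee_fin.
  rewrite /m -fE; last exact: up_open.
  by apply: (cval_le Cm (sopenI _ oU)); try exact: up_open; exact: subIsetl.
have sl p : List.In p l -> p.2 + e < wt s p.1.
  move=> pl; have [h|[x xT px]] := UT p pl.
    rewrite /s wt_cat; apply: (@lt_le_trans _ _ (wt s0 p.1)); last first.
      rewrite lerDl wt_ge0// => q /sT[_ ->]; lra.
    have := s0l p.1 ltac:(by apply/In_map; exists p).
    by move: (e3l p pl); rewrite asboolT// setIT /e; lra.
  apply: (@lt_le_trans _ _ (B + 2)); first by move: (BP p pl); lra.
  apply: (@wt_mem _ s p.1 (B + 2, x)) => //.
  by apply/In_cat; right; apply/In_map; exists x.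
have M0 := wt_ge0 setT sn; set M := wt s setT in M0.
(* With this [d] scaling costs less than [e] on every set, as [M] is the total weight; adding 1
   keeps the denominator positive. *)
pose d := e / (M + 1); pose c := 1 - d.
have d0 : 0 < d by rewrite /d divr_gt0//; lra.
have d1 : d <= 1 by rewrite /d ler_pdivrMr; lra.
have dM : d * M < e by rewrite /d mulrAC ltr_pdivrMr; nra.
have c0 : 0 <= c by rewrite /c; lra.
pose sc := [seq (c * p.1, p.2) | p <- s].
have scn : nonneg_coeffs sc by move=> _ /In_map[p ps <-]; rewrite mulr_ge0// sn.
(* The inequality at [mu] must be strict, which scaling gives only for a positive weight; for weight
   zero the threshold -1 makes the constraint vacuous. *)
pose l' := [seq (up (pts t), if 0 < wt s (pts t) then c * wt s (pts t) else -1)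
  | t <- sublists (map snd s)].
exists (simple le sc), l'; split.
- split; first exact: simple_cval.
  move=> p pl; rewrite simple_wt; last exact: ol.
  rewrite lte_fin wt_scale.
  have : wt s p.1 <= M by apply: wt_mono.
  have := wt_ge0 p.1 sn; have := sl p pl; rewrite /c; set w := wt s p.1 => h1 h2 h3.
  suff : d * w <= d * M by lra.
  by rewrite ler_wpM2l// ltW.
- by move=> _ /In_map[t _ <-]; exact: up_open.
- split=> // _ /In_map[t _ <-] /=; case: ifP => h.
    apply: lt_le_trans (sb _); rewrite lte_fin /c.
    have : 0 < d * wt s (pts t) by rewrite mulr_gt0.
    by lra.
  by apply: lt_le_trans (cval_ge0 Cm _); rewrite lte_fin; lra.
- move=> nu [Cn Hn] V; have [oV|nV] := pselect (op V); last first.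
    by rewrite (cval_out (simple_cval _ scn) nV) (cval_out Cn nV).
  rewrite simple_wt// wt_scale.
  have [t tl tE] := sublists_set (map snd s) V.
  have -> : wt s V = wt s (pts t).
    apply/eqP; rewrite eq_le !wt_mono// => p ps; first by move=> /tE[].
    by move=> Vp; apply/tE; split=> //; apply/In_map; exists p.
  apply: (@le_trans _ _ (nu (up (pts t)))); last first.
    apply: (cval_le Cn) => //; first exact: up_open.
    by apply: up_sub => // x /tE[].
  have [h|h] := ltP 0 (wt s (pts t)).
    apply: ltW; have := Hn (up (pts t), c * wt s (pts t)); apply.
    by apply/In_map; exists t => //; rewrite h.
  have -> : wt s (pts t) = 0 by apply/eqP; rewrite eq_le h wt_ge0.
  by rewrite mulr0; exact: cval_ge0 Cn _.
Qed.

End Approximation.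

(** * The Scott topology of the cone of valuations *)

Section ContinuousCone.
Variables (Y : Type) (le : Y -> Y -> Prop) (domY : is_domain le).
Notation op := (sopen le).
Notation C := (is_cval le).
Notation leV := (@le_val Y).

(** For a singleton these replace the elements way below its point: [z] has a weak neighbourhood of
    that point above it. *)
Definition approximants (A : set (valT Y)) : set (valT Y) := fun z => C z /\
  exists l, [/\ open_list le l, exists2 mu, A mu & weak_nbhd le l mu &
    forall nu, weak_nbhd le l nu -> leV z nu].

Definition irreducible (A : set (valT Y)) := forall U V,
  scott_open C leV U -> scott_open C leV V ->
  (exists2 mu, A mu & U mu) -> (exists2 mu, A mu & V mu) ->
  exists2 mu, A mu & U mu /\ V mu.

Lemma irreducible1 mu : irreducible [set mu].
Proof. by move=> U V _ _ [_ -> Um] [_ -> Vm]; exists mu. Qed.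

(** By irreducibility two weak neighbourhoods meeting [A] share a point of [A]; approximating that
    point under both lists of constraints gives a common upper bound. *)
Lemma approximants_directed A : A `<=` C -> (exists mu, A mu) -> irreducible A ->
  directed C leV (approximants A).
Proof.
move=> AC [m0 A0] iA; split; first by move=> z [].
split.
  have ol : open_list le [::] by [].
  have lm : weak_nbhd le [::] m0 by split=> //; exact: AC.
  have [z [l [[Cz _] oll lmu H]]] := approximation domY (AC _ A0) ol lm.
  by exists z; split=> //; exists l; split=> //; exists m0.
move=> z1 z2 [_ [l1 [o1 m1 H1]]] [_ [l2 [o2 m2 H2]]].
have [mu Am [lm1 lm2]] := iA _ _ (weak_nbhd_open o1) (weak_nbhd_open o2) m1 m2.
have lm : weak_nbhd le (l1 ++ l2) mu by rewrite weak_nbhd_cat.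
have [z [l [lz oll lmu H]]] := approximation domY (AC _ Am) (open_list_cat o1 o2) lm.
exists z; split; first by split; [case: lz|exists l; split=> //; exists mu].
by move: lz; rewrite weak_nbhd_cat => -[/H1 ? /H2 ?].
Qed.

Lemma le_vsup_approximants A mu : A `<=` C -> irreducible A -> A mu ->
  leV mu (vsup (approximants A)).
Proof.
move=> AC iA Am; have Cm := AC _ Am; move=> U.
have dA := approximants_directed AC (ex_intro _ _ Am) iA.
have [oU|nU] := pselect (op U); last first.
  by rewrite (cval_out Cm nU); exact: cval_ge0 (vsup_cval dA) _.
apply: lee_from_below => r rU.
have ol : open_list le [:: (U, r)] by move=> _ [<-|[]].
have lm : weak_nbhd le [:: (U, r)] mu by split=> // _ [<-|[]].
have [z [l [[Cz zU] oll lmu H]]] := approximation domY Cm ol lm.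
apply: (@le_trans _ _ (z U)); first by apply: ltW; apply: (zU (U, r)); left.
by apply: (vsup_ub (D := approximants A)); split=> //; exists l; split=> //; exists mu.
Qed.

(** [mu] is the directed supremum of its approximants, so some approximant lies in [W], and with it
    a weak neighbourhood of [mu]. *)
Lemma scott_open_weak W mu : scott_open C leV W -> W mu ->
  exists l, [/\ open_list le l, weak_nbhd le l mu & weak_nbhd le l `<=` W].
Proof.
move=> oW Wm; have Cm := proj1 oW _ Wm.
have AC : [set mu] `<=` C by move=> _ ->.
have dA := approximants_directed AC (ex_intro _ mu erefl) (@irreducible1 mu).
have E : vsup (approximants [set mu]) = mu.
  apply: le_val_anti; last exact: le_vsup_approximants (@irreducible1 mu) _.
  by apply: vsup_le => z [_ [l [_ [_ -> lm] H]]]; exact: H.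
have [z [[Cz [l [ol [_ -> lm] H]]] Wz]] := scott_open_meets_directed oW dA (vsup_lub dA) ltac:(by rewrite E).
exists l; split=> // nu ln; have [_ [sat _]] := oW.
by apply: (sat z) => //; [case: ln|exact: H].
Qed.

(** Sobriety of the Scott topology: the supremum of the approximants is above [A], and in [A]
    because [A] is closed. *)
Lemma irreducible_top A : scott_closed C leV A -> (exists mu, A mu) -> irreducible A ->
  exists2 e, A e & forall mu, A mu -> leV mu e.
Proof.
move=> /scott_closedVP[AC dn cl] nA iA.
exists (vsup (approximants A)); last by move=> mu; exact: le_vsup_approximants.
apply: cl; first exact: approximants_directed.
by move=> z [Cz [l [_ [mu Am lm] H]]]; apply: dn Am Cz _; exact: H.
Qed.

(* A maximal Scott-open set containing no [K i] is prime, so its complement has a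
   greatest element, which must lie in every [K i]. *)
Lemma well_filtered (I : Type) (J : set I) (K : I -> set (valT Y)) U :
  (exists i, J i) ->
  (forall i, J i -> scott_compact C leV (K i) /\ saturated C leV (K i)) ->
  (forall i j, J i -> J j -> exists2 k, J k & K k `<=` K i `&` K j) ->
  scott_open C leV U -> \bigcap_(i in J) K i `<=` U -> exists2 i, J i & K i `<=` U.
Proof.
move=> [i0 J0] KK Kf oU KU; apply: contrapT => nKU.
(* Joining [U] to [W] makes the empty chain, whose union is empty, satisfy [P]. *)
pose P (W : set (valT Y)) := scott_open C leV W /\ forall i, J i -> ~ (K i `<=` W `|` U).
have [F FP totF|W [[oW nW] maxW]] := @Zorn_bigcup _ P.
  split; first by apply: scott_open_bigcup => W /FP[].
  move=> i Ji Kc; have [[_ kK] _] := KK i Ji.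
  pose G X := (if `[< F X >] then X else set0) `|` U.
  have [X|mu Km|s Hs] := kK _ G.
  - apply: scott_openU => //; case: asboolP => [/FP[]//|_]; exact: scott_open0.
  - have [[X FX Xm]|Um] := Kc _ Km.
      by exists X; rewrite /G asboolT//; left.
    by exists set0; right.
  (* A finite subcover by members of a chain reduces to its largest member, or to [U] alone when no
     member of the chain occurs. *)
  - suff [[X FX XU]|XU] : (exists2 X, F X & K i `<=` X `|` U) \/ K i `<=` U.
    + by have [_ /(_ i Ji)] := FP X FX.
    + by apply: nKU; exists i.
    move: Hs; move: (K i) => Q.
    elim: s Q => [|X s IH] Q Hs; first by right=> mu /Hs[? []].
    have [mu []|[X' FX' XU]|XU] := IH (Q `&` (fun mu => exists X', List.In X' s /\ G X' mu)).
    + by [].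
    + have [FX|nFX] := pselect (F X).
        have [XX|XX] := totF _ _ FX FX'; left; [exists X' => //|exists X => //];
        move=> mu Qm; have [Z [[<-|Zs] GZ]] := Hs _ Qm.
        * by move: GZ; rewrite /G asboolT// => -[/XX|]; [left|right].
        * by apply: XU; split=> //; exists Z.
        * by move: GZ; rewrite /G asboolT.
        * by have [/XX|] := XU mu (conj Qm (ex_intro _ Z (conj Zs GZ))); [left|right].
      left; exists X' => // mu Qm; have [Z [[<-|Zs] GZ]] := Hs _ Qm.
        by move: GZ; rewrite /G asboolF// => -[//|]; right.
      by apply: XU; split=> //; exists Z.
    + have [FX|nFX] := pselect (F X); [left; exists X => //|right];
        move=> mu Qm; have [Z [[<-|Zs] GZ]] := Hs _ Qm.
      * by move: GZ; rewrite /G asboolT.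
      * by right; apply: XU; split=> //; exists Z.
      * by move: GZ; rewrite /G asboolF// => -[].
      * by apply: XU; split=> //; exists Z.
have UW : U `<=` W.
  apply: contrapT => nUW; apply: (maxW (W `|` U)).
    by split=> [x Wx|WU]; [left|apply: nUW => x Ux; apply: WU; right].
  split; first exact: scott_openU.
  by move=> i /nW; rewrite -setUA setUid.
have WE : W `|` U = W by apply/setUidl.
(* Maximality of [W]: enlarging it by any [V] meeting its complement captures some [K i].
   Filteredness of the [K i] then makes the complement irreducible. *)
have ext V : scott_open C leV V -> (exists2 mu, (C `\` W) mu & V mu) ->
    exists2 i, J i & K i `<=` W `|` V.
  move=> oV [mu [_ nWm] Vm]; apply: contrapT => nK; apply: (maxW (W `|` V)).
    by split=> [x Wx|WV]; [left|apply: nWm; apply: WV; right].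
  split; first exact: scott_openU.
  move=> i Ji KW; apply: nK; exists i => //.
  by move: KW; rewrite setUAC WE.
have [||e [Ce nWe] etop] := @irreducible_top (C `\` W) (scott_openC oW).
- apply: contrapT => nE; apply: (nW _ J0); rewrite WE => mu Km.
  apply: contrapT => nWm; apply: nE; exists mu; split=> //.
  by have [[KC _] _] := KK _ J0; exact: KC.
- move=> V1 V2 oV1 oV2 h1 h2.
  have [i Ji Ki] := ext _ oV1 h1; have [j Jj Kj] := ext _ oV2 h2.
  have [k Jk Kk] := Kf _ _ Ji Jj.
  apply: contrapT => nE; apply: (nW _ Jk); rewrite WE => mu Km.
  apply: contrapT => nWm; apply: nE; exists mu.
    by split=> //; have [[KC _] _] := KK _ Jk; exact: KC.
  have [/Ki k1 /Kj k2] := Kk _ Km.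
  by split; [case: k1|case: k2].
apply: nWe; apply: UW; apply: KU => i Ji; apply: contrapT => nKe.
apply: (nW _ Ji); rewrite WE => mu Km; apply: contrapT => nWm; apply: nKe.
have [[KC _] sat] := KK _ Ji.
by apply: (sat mu) => //; apply: etop; split=> //; exact: KC.
Qed.

End ContinuousCone.

(** * Limits of ultrafilters and Lawson compactness *)

Lemma ultra_base (T : Type) (B : set (set T)) : (exists b, B b) ->
  (forall b, B b -> exists x, b x) ->
  (forall b b', B b -> B b' -> exists2 b'', B b'' & b'' `<=` b `&` b') ->
  exists2 F : set_system T, UltraFilter F & B `<=` F.
Proof.
move=> [b0 B0] Bn Bd.
pose G : set_system T := fun S => exists2 b, B b & b `<=` S.
have pG : ProperFilter G.
  split; first by move=> [b /Bn[x bx] /(_ x bx)].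
  split; first by exists b0.
  - move=> S S' [b Bb bS] [b' Bb' bS']; have [b'' Bb'' sb] := Bd _ _ Bb Bb'.
    by exists b'' => // x /sb[/bS ? /bS' ?].
  - by move=> S S' SS' [b Bb bS]; exists b => // x /bS /SS'.
have [F [UF GF]] := ultraFilterLemma pG.
by exists F => // b Bb; apply: GF; exists b.
Qed.

Lemma ereal_between (a b : \bar ERreal) : (0 <= a)%E -> (a < b)%E ->
  exists2 r : ERreal, (a < r%:E)%E & (r%:E < b)%E.
Proof.
case: a => [a||] //; case: b => [b||] // _; last first.
  by move=> _; exists (a + 1); rewrite ?ltry// lte_fin; lra.
by rewrite lte_fin => ab; exists ((a + b) / 2); rewrite lte_fin; lra.
Qed.

Section Coherent.
Variables (Y : Type) (le : Y -> Y -> Prop) (domY : is_domain le).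
Hypothesis cohY : forall p q, scott_compact setT le (fun y => le p y /\ le q y).
Notation op := (sopen le).
Notation C := (is_cval le).
Notation leV := (@le_val Y).
Notation up := (up le).

Lemma coherent_point U p q : op U -> (forall y, le p y -> le q y -> U y) ->
  exists2 G, pts G `<=` U & forall y, le p y -> le q y -> up (pts G) y.
Proof.
move=> oU H; have [_ /(_ Y (fun z => up [set x | x = z /\ U z]))[z|y [py qy]|s Hs]] := cohY p q.
- exact: up_open.
- have [x Ux xy] := up_point domY oU (H y py qy).
  by exists x; exists x.
- exists [seq z <- s | `[< U z >]]; first by move=> z /In_filter[].
  move=> y py qy; have [z [zs [_ [-> Uz] zy]]] := Hs y (conj py qy).
  by exists z => //; apply/In_filter.
Qed.

(** For each pair of points, compactness of the common upper bounds yields a finite list; [G]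
    collects these lists over all pairs. *)
Lemma coherent_lists U U' F F' : op U -> op U' -> pts F `<=` U -> pts F' `<=` U' ->
  exists2 G, pts G `<=` U `&` U' & up (pts F) `&` up (pts F') `<=` up (pts G).
Proof.
move=> oU oU' FU FU'.
have row p : U p -> exists2 G, pts G `<=` U `&` U' &
    forall y, le p y -> up (pts F') y -> up (pts G) y.
  move=> Up; elim: F' FU' => [|q F' IH] FU'.
    by exists [::] => // y _ [].
  have [x qx|G GU HG] := IH; first by apply: FU'; right.
  have [|G' GU' HG'] := coherent_point (p := p) (q := q) (sopenI oU oU').
    by move=> y py qy; split; [exact: sopen_up Up py|apply: sopen_up qy => //; apply: FU'; left].
  exists (G' ++ G); first by move=> x /In_cat[/GU'|/GU].
  move=> y py [x [<-|xF] xy].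
    have [z Gz zy] := HG' y py (wb_le domY xy).
    by exists z => //; apply/In_cat; left.
  have [z Gz zy] := HG y py (ex_intro2 _ _ x xF xy).
  by exists z => //; apply/In_cat; right.
elim: F FU => [|p F IH] FU; first by exists [::] => // y [[]].
have [x px|G GU HG] := IH; first by apply: FU; right.
have [G' GU' HG'] := row p (FU p (or_introl erefl)).
exists (G' ++ G); first by move=> x /In_cat[/GU'|/GU].
move=> y [[x [<-|xF] xy] yF'].
  have [z Gz zy] := HG' y (wb_le domY xy) yF'.
  by exists z => //; apply/In_cat; left.
have [|z Gz zy] := HG y; first by split=> //; exists x.
by exists z => //; apply/In_cat; right.
Qed.

Section Limit.
Variables (F : set_system (valT Y)) (UF : UltraFilter F) (FC : F C).

(** A limit inferior, which along an ultrafilter is the limit of [mu U]. *)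
Definition ultra_value (U : set Y) : \bar ERreal :=
  ereal_sup [set r%:E | r in [set r : ERreal | F [set mu | (r%:E <= mu U)%E]]].

(* The pointwise limit [ultra_value] of the ultrafilter need not be continuous. Its
   regularization is; coherence is what makes the regularization modular. *)
Definition ultra_lim : valT Y := fun U => if `[< op U >] then
  ereal_sup [set ultra_value (up (pts G)) | G in [set G | pts G `<=` U]] else 0%E.

Lemma ultra_inter (A B : set (valT Y)) : F A -> F B -> exists mu, A mu /\ B mu.
Proof.
move=> FA FB; apply: contrapT => nAB.
have PF : ProperFilter F by exact: ultra_proper.
apply: (filter_not_empty F); apply: filterS (filterI FA FB) => mu [Am Bm].
by apply: nAB; exists mu.
Qed.

Lemma ultra_sub (A B : set (valT Y)) : (forall mu, C mu -> A mu -> B mu) -> F A -> F B.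
Proof.
move=> AB FA; have PF : ProperFilter F by exact: ultra_proper.
by apply: filterS (filterI FC FA) => mu [Cm Am]; exact: AB.
Qed.

Lemma ultra_value_ge r U : F [set mu | (r%:E <= mu U)%E] -> (r%:E <= ultra_value U)%E.
Proof. by move=> H; apply: mem_le_ereal_sup; exists r. Qed.

Lemma ultra_value_lt r U : (ultra_value U < r%:E)%E -> F [set mu | (mu U < r%:E)%E].
Proof.
move=> H; have [h|h] := in_ultra_setVsetC [set mu | (r%:E <= mu U)%E] UF.
  by have := ultra_value_ge h; rewrite leNgt H.
by apply: ultra_sub h => mu _ /= /negP; rewrite -ltNge.
Qed.

Lemma ultra_value_zero U : F [set mu | (0%:E <= mu U)%E].
Proof. by apply: ultra_sub FC => mu Cm _; exact: cval_ge0 Cm _. Qed.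

Lemma ultra_value_ge0 U : (0 <= ultra_value U)%E.
Proof. exact: ultra_value_ge (ultra_value_zero U). Qed.

Lemma ultra_value_add U V W X : (forall mu, C mu -> (mu U + mu V <= mu W + mu X)%E) ->
  (ultra_value U + ultra_value V <= ultra_value W + ultra_value X)%E.
Proof.
move=> H; have nn := ultra_value_ge0.
have [fW|] := boolP (ultra_value W < +oo)%E; last first.
  by rewrite -leNgt leye_eq => /eqP->; rewrite addye ?leey// gt_eqF// (lt_le_trans _ (nn X)).
have [fX|] := boolP (ultra_value X < +oo)%E; last first.
  by rewrite -leNgt leye_eq => /eqP->; rewrite addey ?leey// gt_eqF// (lt_le_trans _ (nn W)).
have EW : ultra_value W = (fine (ultra_value W))%:E by rewrite fineK// ge0_fin_numE.
have EX : ultra_value X = (fine (ultra_value X))%:E by rewrite fineK// ge0_fin_numE.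
(* negative reals are also in the set defining [ultra_value] *)
have Emax U' : ultra_value U' =
    ereal_sup [set r%:E | r in [set r : ERreal | 0 <= r /\ F [set mu | (r%:E <= mu U')%E]]].
  apply/eqP; rewrite eq_le; apply/andP; split; apply: ge_ereal_sup => _ [r Fr <-]; last first.
    by apply: ultra_value_ge; case: Fr.
  have [r0|r0] := ltP r 0; last by apply: mem_le_ereal_sup; exists r.
  apply: (@le_trans _ _ 0%:E); first by rewrite lee_fin ltW.
  by apply: mem_le_ereal_sup; exists 0 => //; split=> //; exact: ultra_value_zero.
rewrite (Emax U) (Emax V); apply: ereal_sup_addle.
- by exists 0%:E; exists 0 => //; split=> //; exact: ultra_value_zero.
- by exists 0%:E; exists 0 => //; split=> //; exact: ultra_value_zero.
- by move=> _ [r [r0 _] <-]; rewrite lee_fin.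
- by move=> _ [r [r0 _] <-]; rewrite lee_fin.
move=> _ _ [r [_ Fr] <-] [s [_ Fs] <-].
set w := fine _ in EW; set x := fine _ in EX.
rewrite EW EX -!EFinD lee_fin leNgt; apply/negP => lt.
(* Half of the assumed gap, granted once to [W] and once to [X]. *)
pose e := (r + s - (w + x)) / 2.
have e0 : 0 < e by rewrite /e; lra.
have FW : F [set mu | (mu W < (w + e)%:E)%E].
  by apply: ultra_value_lt; rewrite EW lte_fin; lra.
have FX : F [set mu | (mu X < (x + e)%:E)%E].
  by apply: ultra_value_lt; rewrite EX lte_fin; lra.
have PF : ProperFilter F by exact: ultra_proper.
have [mu [[Fr' Fs'] [[FW' FX'] Cm]]] :=
  ultra_inter (filterI Fr Fs) (filterI (filterI FW FX) FC).
have h1 := leeD Fr' Fs'; have h2 := lteD FW' FX'.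
have := le_lt_trans h1 (le_lt_trans (H _ Cm) h2).
by rewrite -!EFinD lte_fin /e; lra.
Qed.

Lemma ultra_lim_ge U G : op U -> pts G `<=` U ->
  (ultra_value (up (pts G)) <= ultra_lim U)%E.
Proof. by move=> oU GU; rewrite /ultra_lim asboolT//; apply: mem_le_ereal_sup; exists G. Qed.

Lemma ultra_lim_le U t : op U ->
  (forall G, pts G `<=` U -> (ultra_value (up (pts G)) <= t)%E) -> (ultra_lim U <= t)%E.
Proof.
move=> oU H; rewrite /ultra_lim asboolT//; apply: ge_ereal_sup => _ [G GU <-].
exact: H.
Qed.

Lemma ultra_lim_ge0 U : (0 <= ultra_lim U)%E.
Proof.
rewrite /ultra_lim; case: asboolP => // oU; apply: le_trans (ultra_value_ge0 (up (pts [::]))) _.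
by apply: mem_le_ereal_sup; exists [::].
Qed.

Lemma up_pts_cat G G' : up (pts (G ++ G')) = up (pts G) `|` up (pts G').
Proof.
rewrite -up_setU; congr up; apply/seteqP; split=> x; first by move=> /In_cat.
by move=> ?; apply/In_cat.
Qed.

Lemma ultra_lim_modular U V : op U -> op V ->
  (ultra_lim U + ultra_lim V = ultra_lim (U `|` V) + ultra_lim (U `&` V))%E.
Proof.
move=> oU oV; have oUV := sopenU oU oV; have oIV := sopenI oU oV.
have addle A B t : op A -> op B ->
    (forall G H, pts G `<=` A -> pts H `<=` B ->
      (ultra_value (up (pts G)) + ultra_value (up (pts H)) <= t)%E) ->
    (ultra_lim A + ultra_lim B <= t)%E.
  move=> oA oB h; rewrite /ultra_lim !asboolT//; apply: ereal_sup_addle.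
  - by exists (ultra_value (up (pts [::]))), [::].
  - by exists (ultra_value (up (pts [::]))), [::].
  - by move=> _ [G _ <-]; exact: ultra_value_ge0.
  - by move=> _ [G _ <-]; exact: ultra_value_ge0.
  - by move=> _ _ [G GA <-] [H HB <-]; exact: h.
apply/eqP; rewrite eq_le; apply/andP; split; apply: addle => // G H GU HV.
  (* The intersection of the two way-above sets need not come from a finite set, but coherence
     encloses it in one that does. *)
  have [K KUV HK] := coherent_lists oU oV GU HV.
  apply: (@le_trans _ _ (ultra_value (up (pts (G ++ H))) + ultra_value (up (pts K)))%E).
    apply: ultra_value_add => mu Cm.
    rewrite (cval_mod Cm (up_open domY _) (up_open domY _)) up_pts_cat leeD2l//.
    by apply: (cval_le Cm) => //; [apply: sopenI|]; exact: up_open.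
  apply: leeD; apply: ultra_lim_ge => //.
  by move=> x /In_cat[/GU|/HV]; [left|right].
(* The points of the union are sorted into [U] and [V]; those of the intersection go into both
   lists. *)
pose G1 := [seq x <- G | `[< U x >]] ++ H; pose G2 := [seq x <- G | `[< V x >]] ++ H.
apply: (@le_trans _ _ (ultra_value (up (pts G1)) + ultra_value (up (pts G2)))%E); last first.
  apply: leeD; apply: ultra_lim_ge => // x /In_cat[/In_filter[]//|/HV[]//].
apply: ultra_value_add => mu Cm.
rewrite (cval_mod Cm (up_open domY (pts G1)) (up_open domY (pts G2))).
have o1 := up_open domY (pts G1); have o2 := up_open domY (pts G2).
apply: leeD; apply: (cval_le Cm); try exact: up_open.
- exact: sopenU.
- move=> y [x xG xy]; have [Ux|Vx] := GU _ xG; [left|right]; exists x => //;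
  by apply/In_cat; left; apply/In_filter.
- exact: sopenI.
- by move=> y [x xH xy]; split; exists x => //; apply/In_cat; right.
Qed.

Lemma ultra_lim_cval : C ultra_lim.
Proof.
apply: cval_intro.
- by move=> U nU; rewrite /ultra_lim asboolF.
- exact: ultra_lim_ge0.
- apply/eqP; rewrite eq_le ultra_lim_ge0 andbT.
  apply: ultra_lim_le; first exact: sopen0.
  move=> G G0; apply: ge_ereal_sup => _ [r Fr <-].
  have [mu [h Cm]] := ultra_inter Fr FC.
  apply: le_trans h _; have -> : up (pts G) = set0.
    by apply/seteqP; split=> // y [x /G0].
  by rewrite (cval0 Cm).
- move=> U V oU oV UV; apply: ultra_lim_le => // G GU.
  by apply: ultra_lim_ge => // x /GU /UV.
- exact: ultra_lim_modular.
- move=> D D1 [U0 DU0] D3; apply: ultra_lim_le; first exact: sopen_bigcup.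
  move=> G GD; have [U DU GU] : exists2 U, D U & pts G `<=` U.
    elim: G GD => [|x G IH] GD; first by exists U0.
    have [y yG|U DU GU] := IH; first by apply: GD; right.
    have [V DV Vx] := GD x (or_introl erefl).
    have [W [DW [UW VW]]] := D3 _ _ DU DV.
    by exists W => // y [<-|/GU/UW//]; exact: VW.
  apply: (@le_trans _ _ (ultra_lim U)); last by apply: mem_le_ereal_sup; exists U.
  by apply: ultra_lim_ge => //; exact: D1.
Qed.

Lemma ultra_lim_weak l : open_list le l -> weak_nbhd le l ultra_lim -> F (weak_nbhd le l).
Proof.
have PF : ProperFilter F by exact: ultra_proper.
elim: l => [|p l IH] ol [_ H]; first by apply: ultra_sub FC => mu Cm _.
have op1 : op p.1 by apply: ol; left.
have Fl : F (weak_nbhd le l).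
  apply: IH; first by move=> q ql; apply: ol; right.
  by split=> [|q ql]; [exact: ultra_lim_cval|apply: H; right].
have := H p (or_introl erefl); rewrite {1}/ultra_lim asboolT//.
move=> /ereal_sup_gt[_ [G GU <-] /ereal_sup_gt[_ [r Fr <-] pr]].
apply: ultra_sub (filterI Fr Fl) => mu Cm [/= h [_ Hl]]; split=> // q [<-|/Hl//].
apply: lt_le_trans pr _; apply: le_trans h _.
by apply: (cval_le Cm) => //; [exact: up_open|exact: up_sub].
Qed.

(** The ultrafilter converges to [ultra_lim] weakly, hence in the Scott topology, which has the same
    neighbourhoods. *)
Lemma ultra_lim_scott_open W : scott_open C leV W -> W ultra_lim -> F W.
Proof.
move=> oW Wl; have [l [ol ll lW]] := scott_open_weak domY oW Wl.
by apply: ultra_sub (ultra_lim_weak ol ll) => mu _; exact: lW.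
Qed.

Lemma ultra_lim_scott_closed A : scott_closed C leV A -> F A -> A ultra_lim.
Proof.
move=> [_ oA] FA; apply: contrapT => nA.
have FcA := ultra_lim_scott_open oA (conj ultra_lim_cval nA).
by have [mu [Am [_ nAm]]] := ultra_inter FA FcA.
Qed.

(** Shrinking the open set to some [up (pts G)] moves the gap from the regularization to
    [ultra_value], where it speaks about almost all members of the ultrafilter. *)
Lemma not_le_ultra_lim mu : C mu -> ~ leV mu ultra_lim ->
  exists V r, [/\ op V, (ultra_value V < r%:E)%E & (r%:E < mu V)%E].
Proof.
move=> Cm /existsNP[U /negP]; rewrite -ltNge => lt.
have oU : op U.
  apply: contrapT => nU; move: lt; rewrite (cval_out Cm nU) ltNge.
  by rewrite ultra_lim_ge0.
have [G GU lt'] := cval_approx domY Cm oU lt.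
have [r lr rm] := ereal_between (ultra_lim_ge0 U) lt'.
exists (up (pts G)), r; split=> //; first exact: up_open.
by apply: le_lt_trans lr; exact: ultra_lim_ge.
Qed.

(** Otherwise no point of [K] is below the limit, so each has a weak neighbourhood that the
    ultrafilter avoids, and finitely many of these cover [K]. *)
Lemma ultra_lim_compact K : scott_compact C leV K -> saturated C leV K ->
  F K -> K ultra_lim.
Proof.
move=> [KC kK] sK FK; apply: contrapT => nK.
have PF : ProperFilter F by exact: ultra_proper.
pose W (p : set Y * ERreal) : set (valT Y) :=
  if `[< op p.1 /\ (ultra_value p.1 < p.2%:E)%E >] then weak_nbhd le [:: p] else set0.
have [p|mu Km|s Hs] := kK _ W.
- rewrite /W; case: asboolP => [[op1 _]|_]; last exact: scott_open0.
  by apply: weak_nbhd_open => q [<-|[]].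
- have [|V [r [oV Vr rm]]] := @not_le_ultra_lim mu (KC _ Km).
    by move=> ml; apply: nK; exact: (sK mu _ Km ultra_lim_cval ml).
  by exists (V, r); rewrite /W asboolT//; split=> [|_ [<-|[]]//]; exact: KC.
- have Fs : F [set mu | forall p, List.In p s -> ~ W p mu].
    elim: s {Hs} => [|p s IH]; first by apply: ultra_sub FC => mu _ _ p [].
    have Fp : F [set mu | ~ W p mu].
      have [h|h] := pselect (op p.1 /\ (ultra_value p.1 < p.2%:E)%E).
        apply: ultra_sub (ultra_value_lt (proj2 h)) => mu _ /= lt.
        rewrite /W asboolT// => -[_ /(_ p (or_introl erefl))].
        by rewrite ltNge (ltW lt).
      by apply: ultra_sub FC => mu _ _; rewrite /= /W asboolF.
    by apply: ultra_sub (filterI Fp IH) => mu _ [h1 h2] q [<-|/h2].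
  have [mu [Km Hm]] := ultra_inter FK Fs.
  by have [p [ps Wp]] := Hs _ Km; exact: Hm ps Wp.
Qed.

End Limit.

Lemma principal_compact z : C z -> scott_compact C leV (upset C leV [set z]).
Proof.
move=> Cz; split; first by move=> mu [].
move=> I U oU cov; have [|i Ui] := cov z.
  by split=> //; exists z; split=> //; exact: le_val_refl.
exists [:: i] => mu [Cm [_ [-> zm]]]; exists i; split; first by left.
by have [_ [sat _]] := oU i; exact: (sat z).
Qed.

Lemma principal_closed z : C z -> scott_closed C leV (downset C leV [set z]).
Proof.
move=> Cz; apply/scott_closedVP; split; first by move=> mu [].
- move=> x y [Cx [_ [-> xz]]] Cy yx; split=> //; exists z; split=> //.
  exact: le_val_trans yx xz.
- move=> D dD DA; split; first exact: vsup_cval.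
  by exists z; split=> //; apply: vsup_le => mu /DA[_ [_ [-> ]]].
Qed.

(* By [patch_closed_lawson] and [lawson_patch_closed] these are exactly the
   Lawson-compact sets. *)
Definition patch_closed (Q : set (valT Y)) := Q `<=` C /\
  forall F, UltraFilter F -> F Q -> Q (ultra_lim F).

Lemma patch_closedI Q Q' : patch_closed Q -> patch_closed Q' -> patch_closed (Q `&` Q').
Proof.
move=> [QC HQ] [_ HQ']; split; first by move=> mu [/QC].
move=> F UF FQ; have PF : ProperFilter F by exact: ultra_proper.
by split; [apply: HQ|apply: HQ'] => //; apply: filterS FQ => mu [].
Qed.

Lemma patch_closed_scott A : scott_closed C leV A -> patch_closed A.
Proof.
move=> cA; have [AC _] := cA; split=> // F UF FA.
have PF : ProperFilter F by exact: ultra_proper.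
by apply: ultra_lim_scott_closed => //; exact: filterS FA.
Qed.

Lemma patch_closed_compact K : scott_compact C leV K -> saturated C leV K ->
  patch_closed K.
Proof.
move=> kK sK; have [KC _] := kK; split=> // F UF FK.
have PF : ProperFilter F by exact: ultra_proper.
by apply: ultra_lim_compact => //; exact: filterS FK.
Qed.

Lemma patch_closed_principal z : C z -> patch_closed (upset C leV [set z]).
Proof.
by move=> Cz; apply: patch_closed_compact; [exact: principal_compact|exact: upset_saturated].
Qed.

Lemma patch_closed_fip (I : Type) (J : set I) (Q : I -> set (valT Y)) :
  (exists i, J i) -> (forall i, J i -> patch_closed (Q i)) ->
  (forall i, J i -> exists mu, Q i mu) ->
  (forall i j, J i -> J j -> exists2 k, J k & Q k `<=` Q i `&` Q j) ->
  exists mu, forall i, J i -> Q i mu.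
Proof.
move=> [i0 J0] pQ nQ dQ.
have [|_ [i Ji <-]|_ _ [i Ji <-] [j Jj <-]|F UF BF] :=
    @ultra_base _ [set Q i | i in J].
- by exists (Q i0), i0.
- exact: nQ.
- by have [k Jk H] := dQ _ _ Ji Jj; exists (Q k) => //; exists k.
exists (ultra_lim F) => i Ji; apply: (proj2 (pQ i Ji)) => //.
by apply: BF; exists i.
Qed.

Lemma scott_lawson_open W : scott_open C leV W -> lawson_open C leV W.
Proof.
move=> oW; split; first exact: (proj1 oW).
move=> x Wx; exists [:: W]; split; first by move=> _ [<-|[]]; left.
split; first by move=> _ [<-|[]].
by move=> y [_ /(_ W (or_introl erefl))].
Qed.

Lemma principal_lawson_open z : C z -> lawson_open C leV (C `\` upset C leV [set z]).
Proof.
move=> Cz; set W := _ `\` _; split; first by move=> mu [].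
move=> x Wx; exists [:: W]; split; first by move=> _ [<-|[]]; right; exists z.
split; first by move=> _ [<-|[]].
by move=> y [_ /(_ W (or_introl erefl))].
Qed.

(** Without a finite subcover some ultrafilter on [Q] avoids every [U i]. Its limit lies in one of
    them, and the subbasic sets around the limit belong to the ultrafilter: Scott-open ones by
    convergence, complements of principal upper sets because these are patch-closed. *)
Lemma patch_closed_lawson Q : patch_closed Q -> lawson_compact C leV Q.
Proof.
move=> [QC HQ]; split=> // I U oU cov; apply: contrapT => ns.
pose B (s : seq I) := Q `&` [set mu | forall i, List.In i s -> ~ U i mu].
have [|_ [s _ <-]|_ _ [s _ <-] [t _ <-]|F UF BF] := @ultra_base _ [set B s | s in setT].
- by exists (B [::]), [::].
- apply: contrapT => nB; apply: ns; exists s => mu Qm; apply: contrapT => nU.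
  by apply: nB; exists mu; split=> // i is' Ui; apply: nU; exists i.
- exists (B (s ++ t)); first by exists (s ++ t).
  by move=> mu [Qm H]; split; split=> // i h; apply: H; apply/In_cat; [left|right].
have PF : ProperFilter F by exact: ultra_proper.
have FQ : F Q by apply: filterS (BF (B [::]) _) => [mu []//|]; exists [::].
have FC : F C by exact: filterS FQ.
have Ql := HQ F UF FQ; have [i Ui] := cov _ Ql.
have [_ /(_ _ Ui)[Ss [sub [mem incl]]]] := oU i.
have FS : F [set mu | forall S, List.In S Ss -> S mu].
  elim: Ss sub mem {incl} => [|S Ss IH] sub mem.
    by apply: filterS FC => mu _ S [].
  have FS : F S.
    have Sl := mem S (or_introl erefl).
    have [oS|[z [Cz ES]]] := sub S (or_introl erefl).
      exact: ultra_lim_scott_open.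
    have [//|FnS] := in_ultra_setVsetC S UF.
    exfalso; move: Sl; rewrite ES => -[_]; apply.
    apply: (proj2 (patch_closed_principal Cz)) => //.
    apply: filterS (filterI FC FnS) => mu [Cm]; rewrite ES => nS.
    by apply: contrapT => nz; exact: nS.
  have FSs : F [set mu | forall S', List.In S' Ss -> S' mu].
    by apply: IH => S' h; [apply: sub|apply: mem]; right.
  by apply: filterS (filterI FS FSs) => mu [h1 h2] S' [<-|/h2].
have FB : F (B [:: i]) by apply: BF; exists [:: i].
have [mu [[Cm Hm] [_ Bm]]] := ultra_inter UF (filterI FC FS) FB.
by apply: (Bm i); [left|apply: incl].
Qed.

(** Compactness yields some Lawson limit [a] in [Q]; Lawson limits are unique, so [a] is
    [ultra_lim F]. *)
Lemma lawson_patch_closed Q : lawson_compact C leV Q -> patch_closed Q.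
Proof.
move=> [QC kQ]; split=> // F UF FQ.
have PF : ProperFilter F by exact: ultra_proper.
have FC : F C by exact: filterS FQ.
have [a Qa Ha] : exists2 a, Q a & forall W, lawson_open C leV W -> W a -> F W.
  apply: contrapT => nE.
  pose W X := if `[< lawson_open C leV X /\ ~ F X >] then X else set0 : set (valT Y).
  have [X|mu Qm|s Hs] := kQ _ W.
  - rewrite /W; case: asboolP => [[]//|_]; exact: scott_lawson_open (scott_open0 _ _).
  - apply: contrapT => nX; apply: nE; exists mu => // X oX Xm.
    by apply: contrapT => nF; apply: nX; exists X; rewrite /W asboolT.
  - have Fs : F [set mu | forall X, List.In X s -> ~ W X mu].
      elim: s {Hs} => [|X s IH]; first by apply: filterS FC => mu _ X [].
      have FX : F [set mu | ~ W X mu].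
        rewrite /W; case: asboolP => [[oX nF]|_].
          by have [|] := in_ultra_setVsetC X UF.
        by apply: filterS FC => mu _ [].
      by apply: filterS (filterI FX IH) => mu [h1 h2] X' [<-|/h2].
    have [mu [Qm Hm]] := ultra_inter UF FQ Fs.
    by have [X [Xs WX]] := Hs _ Qm; exact: Hm Xs WX.
suff -> : ultra_lim F = a by [].
have Ca := QC _ Qa; have Cl := ultra_lim_cval UF FC.
apply: le_val_anti.
  apply: le_val_trans (@le_vsup_approximants _ _ domY [set ultra_lim F] _ _ _ _) _ => //.
  - by move=> _ ->.
  - exact: irreducible1.
  (* If an approximant [z] of the limit were not below [a], the ultrafilter would contain both a set
     above [z] and the complement of the upper set of [z]. *)
  apply: vsup_le => z [Cz [l [ol [_ -> ll] H]]]; apply: contrapT => nz.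
  have Fz : F (C `\` upset C leV [set z]).
    apply: Ha; first exact: principal_lawson_open.
    by split=> // -[_ [_ [-> ]]].
  have [mu [lm [Cm nm]]] := ultra_inter UF (ultra_lim_weak UF FC ol ll) Fz.
  by apply: nm; split=> //; exists z; split=> //; exact: H.
apply: contrapT => nle.
have [V [r [oV Vr rm]]] := not_le_ultra_lim UF FC Ca nle.
have ol : open_list le [:: (V, r)] by move=> _ [<-|[]].
have Fr : F (weak_nbhd le [:: (V, r)]).
  apply: Ha; first by apply: scott_lawson_open; exact: weak_nbhd_open.
  by split=> // _ [<-|[]].
have [mu [lt [_ /(_ (V, r) (or_introl erefl)) /= lt']]] :=
  ultra_inter UF (ultra_value_lt UF FC Vr) Fr.
by have := lt_trans lt lt'; rewrite ltxx.
Qed.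

(** For [x] in the closure, the traces on [Q] of the weak neighbourhoods of [x] generate an
    ultrafilter whose limit lies in [Q] and above [x]. *)
Lemma patch_closed_closure Q : patch_closed Q ->
  scott_closure C leV Q = downset C leV Q.
Proof.
move=> [QC HQ]; apply/seteqP; split=> x; last first.
  move=> [Cx [a [Qa xa]]].
  have /scott_closedVP[_ dn _] := scott_closure_closed C leV Q.
  by apply: dn (sub_scott_closure leV QC Qa) Cx xa.
move=> clx; have Cx : C x by case: clx.
pose B l := Q `&` weak_nbhd le l.
pose J := [set l | open_list le l /\ weak_nbhd le l x].
have [|_ [l [ol lx] <-]|_ _ [l [ol lx] <-] [k [ok kx] <-]|F UF BF] :=
    @ultra_base _ [set B l | l in J].
- by exists (B [::]), [::].
- have [mu [Qm lm]] := scott_closure_meets QC clx (weak_nbhd_open ol) lx.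
  by exists mu.
- exists (B (l ++ k)); first by exists (l ++ k) => //; split;
    [exact: open_list_cat|rewrite weak_nbhd_cat].
  by move=> mu [Qm]; rewrite weak_nbhd_cat => -[].
have PF : ProperFilter F by exact: ultra_proper.
have FB l : open_list le l -> weak_nbhd le l x -> F (B l).
  by move=> ol lx; apply: BF; exists l.
have FQ : F Q.
  by apply: filterS (FB [::] _ _) => // mu [].
have FC : F C by exact: filterS FQ.
split=> //; exists (ultra_lim F); split; first exact: HQ.
move=> U; have [oU|nU] := pselect (op U); last first.
  by rewrite (cval_out Cx nU); exact: ultra_lim_ge0 UF FC U.
apply: lee_from_below => r /(cval_approx domY Cx oU)[G GU rG].
apply: le_trans (ultra_lim_ge _ oU GU); apply: ultra_value_ge.
apply: filterS (FB [:: (up (pts G), r)] _ _).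
- by move=> mu [_ [_ /(_ (up (pts G), r) (or_introl erefl))/ltW]].
- by move=> _ [<-|[]]; exact: up_open.
- by split=> // _ [<-|[]].
Qed.

End Coherent.

(** * Products of domains *)

Section ProductOrder.
Variables (X T : Type) (leX : X -> X -> Prop) (P : set T) (leT : T -> T -> Prop).
Notation PP := (fun p : X * T => P p.2).
Notation leXT := (prod_le leX leT).

(** Relativizing the second factor to [P] lets the same lemmas serve products of domains and
    products with a powercone. *)
Lemma directed_fst D : directed PP leXT D -> directed setT leX (fst @` D).
Proof.
move=> [DP [[d0 D0] dir]]; split=> //; split; first by exists d0.1, d0.
move=> _ _ [p Dp <-] [q Dq <-]; have [r [Dr [[? _] [? _]]]] := dir _ _ Dp Dq.
by exists r.1; split=> //; exists r.
Qed.

Lemma directed_snd D : directed PP leXT D -> directed P leT (snd @` D).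
Proof.
move=> [DP [[d0 D0] dir]]; split; first by move=> _ [p /DP Pp <-].
split; first by exists d0.2, d0.
move=> _ _ [p Dp <-] [q Dq <-]; have [r [Dr [[_ ?] [_ ?]]]] := dir _ _ Dp Dq.
by exists r.2; split=> //; exists r.
Qed.

Lemma lub_fst D s : is_lub PP leXT D s -> is_lub setT leX (fst @` D) s.1.
Proof.
move=> [Ps [ub least]]; split=> //; split; first by move=> _ [p /ub[? _] <-].
move=> u _ uu; have [|//] := least (u, s.2) Ps.
by move=> p Dp; split; [apply: uu; exists p|case: (ub p Dp)].
Qed.

Lemma lub_snd D s : is_lub PP leXT D s -> is_lub P leT (snd @` D) s.2.
Proof.
move=> [Ps [ub least]]; split=> //; split; first by move=> _ [p /ub[_ ?] <-].
move=> u Pu uu; have [|//] := least (s.1, u) Pu.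
by move=> p Dp; split; [case: (ub p Dp)|apply: uu; exists p].
Qed.

Lemma lub_pair D s : is_lub setT leX (fst @` D) s.1 -> is_lub P leT (snd @` D) s.2 ->
  is_lub PP leXT D s.
Proof.
move=> [_ [ub1 l1]] [Ps [ub2 l2]]; split=> //; split.
  by move=> p Dp; split; [apply: ub1|apply: ub2]; exists p.
move=> u Pu uu; split; [apply: l1 => //|apply: l2 => //] => _ [p Dp <-].
  by case: (uu p Dp).
by case: (uu p Dp).
Qed.

End ProductOrder.

Section ScottMaps.
Variables (X Y X' Y' : Type) (leX : X -> X -> Prop) (leY : Y -> Y -> Prop).
Variables (leX' : X' -> X' -> Prop) (leY' : Y' -> Y' -> Prop).

Lemma scott_cont_pair a : (forall b, leX b b) ->
  scott_cont setT leY setT (prod_le leX leY) (fun y => (a, y)).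
Proof.
move=> rX; split=> //; split; first by move=> y y' _ _ yy.
move=> D s [_ [[d0 D0] _]] lD; apply: (@lub_pair _ _ leX setT leY).
  split=> //; split; first by move=> _ [_ [y _ <-] <-]; exact: rX.
  by move=> u _; apply; exists (a, d0) => //; exists d0.
by rewrite image_comp /comp /= image_id.
Qed.

Lemma scott_cont_snd : scott_cont setT (prod_le leX leY) setT leY snd.
Proof.
split=> //; split; first by move=> p q _ _ [].
by move=> D s _; exact: (@lub_snd _ _ leX setT leY).
Qed.

Lemma scott_cont_prod f g :
  scott_cont setT leX setT leX' f -> scott_cont setT leY setT leY' g ->
  scott_cont setT (prod_le leX leY) setT (prod_le leX' leY') (fun p => (f p.1, g p.2)).
Proof.
move=> [_ [mf lf]] [_ [mg lg]]; split=> //; split.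
  by move=> p q _ _ [h1 h2]; split; [exact: mf|exact: mg].
move=> D s dD lD; apply: (@lub_pair _ _ leX' setT leY').
  have := lf _ _ (@directed_fst _ _ leX setT leY D dD) (@lub_fst _ _ leX setT leY D s lD).
  by rewrite !image_comp.
have := lg _ _ (@directed_snd _ _ leX setT leY D dD) (@lub_snd _ _ leX setT leY D s lD).
by rewrite !image_comp.
Qed.

End ScottMaps.

Lemma scott_cont_assoc3 (X Y Z : Type) (leX : X -> X -> Prop) (leY : Y -> Y -> Prop)
    (leZ : Z -> Z -> Prop) :
  scott_cont setT (prod_le (prod_le leX leY) leZ) setT (prod_le leX (prod_le leY leZ))
    (@assoc3 X Y Z).
Proof.
split=> //; split; first by move=> p q _ _ [[? ?] ?].
move=> D s dD lD.
have d1 := @directed_fst _ _ (prod_le leX leY) setT leZ D dD.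
have l1 := @lub_fst _ _ (prod_le leX leY) setT leZ D s lD.
have l2 := @lub_snd _ _ (prod_le leX leY) setT leZ D s lD.
have l11 := @lub_fst _ _ leX setT leY _ _ l1.
have l12 := @lub_snd _ _ leX setT leY _ _ l1.
apply: (@lub_pair _ _ leX setT (prod_le leY leZ)).
  by move: l11; rewrite !image_comp.
apply: (@lub_pair _ _ leY setT leZ).
  by move: l12; rewrite !image_comp.
by move: l2; rewrite !image_comp.
Qed.

Section ProductDomain.
Variables (X Y : Type) (leX : X -> X -> Prop) (leY : Y -> Y -> Prop).
Hypotheses (domX : is_domain leX) (domY : is_domain leY).
Notation leXY := (prod_le leX leY).

Lemma way_below_pair a b a' b' : way_below leX a a' -> way_below leY b b' ->
  way_below leXY (a, b) (a', b').
Proof.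
move=> aa bb D s dD lD [/= as' bs'].
have [_ [[p Dp <-] ap]] := aa _ _ (@directed_fst _ _ leX setT leY D dD)
  (@lub_fst _ _ leX setT leY D s lD) as'.
have [_ [[q Dq <-] bq]] := bb _ _ (@directed_snd _ _ leX setT leY D dD)
  (@lub_snd _ _ leX setT leY D s lD) bs'.
have [_ [_ dir]] := dD; have [r [Dr [[pr _] [_ qr]]]] := dir _ _ Dp Dq.
exists r; split=> //; split; first exact: dom_trans domX _ _ _ ap pr.
exact: dom_trans domY _ _ _ bq qr.
Qed.

Lemma way_below_fst p q : way_below leXY p q -> way_below leX p.1 q.1.
Proof.
move=> pq D s dD lD qs; have [_ [[d0 D0] dir]] := dD.
have [||//|_ [[d Dd <-] [pd _]]] := pq [set (d, q.2) | d in D] (s, q.2); last by exists d.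
- split=> //; split; first by exists (d0, q.2), d0.
  move=> _ _ [d Dd <-] [e De <-]; have [z [Dz [dz ez]]] := dir _ _ Dd De.
  exists (z, q.2); split; first by exists z.
  by split; split=> //; exact: dom_refl.
- apply: (@lub_pair _ _ leX setT leY); first by rewrite image_comp /comp /= image_id.
  split=> //; split; first by move=> _ [_ [d _ <-] <-]; exact: dom_refl.
  by move=> u _; apply; exists (d0, q.2) => //; exists d0.
- by split=> //; exact: dom_refl.
Qed.

Lemma way_below_snd p q : way_below leXY p q -> way_below leY p.2 q.2.
Proof.
move=> pq D s dD lD qs; have [_ [[d0 D0] dir]] := dD.
have [||//|_ [[d Dd <-] [_ pd]]] := pq [set (q.1, d) | d in D] (q.1, s); last by exists d.
- split=> //; split; first by exists (q.1, d0), d0.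
  move=> _ _ [d Dd <-] [e De <-]; have [z [Dz [dz ez]]] := dir _ _ Dd De.
  exists (q.1, z); split; first by exists z.
  by split; split=> //; exact: dom_refl.
- apply: (@lub_pair _ _ leX setT leY); last by rewrite image_comp /comp /= image_id.
  split=> //; split; first by move=> _ [_ [d _ <-] <-]; exact: dom_refl.
  by move=> u _; apply; exists (q.1, d0) => //; exists d0.
- by split=> //; exact: dom_refl.
Qed.

Lemma prod_domain : is_domain leXY.
Proof.
have [[_ cX] _] := domX; have [[_ cY] _] := domY.
split.
  split.
    split; first by move=> p; split; exact: dom_refl.
    split; first by move=> p q r [h1 h2] [h3 h4]; split;
      [exact: dom_trans domX _ _ _ h1 h3|exact: dom_trans domY _ _ _ h2 h4].
    have [[[_ [_ aX]] _] _] := domX; have [[[_ [_ aY]] _] _] := domY.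
    by move=> [a b] [c d] [/= h1 h2] [/= h3 h4]; rewrite (aX _ _ h1 h3) (aY _ _ h2 h4).
  move=> D dD.
  have [s sP] := cX _ (@directed_fst _ _ leX setT leY D dD).
  have [t tP] := cY _ (@directed_snd _ _ leX setT leY D dD).
  by exists (s, t); apply: (@lub_pair _ _ leX setT leY).
move=> [x y].
have [_ [[x0 x0x] dirx]] := wb_directed domX x.
have [_ [[y0 y0y] diry]] := wb_directed domY y.
split.
  split=> //; split; first by exists (x0, y0); exact: way_below_pair.
  move=> p q px qx.
  have [a [ax [pa qa]]] := dirx _ _ (way_below_fst px) (way_below_fst qx).
  have [b [bx [pb qb]]] := diry _ _ (way_below_snd px) (way_below_snd qx).
  by exists (a, b); split; first exact: way_below_pair.
apply: (@lub_pair _ _ leX setT leY).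
  suff -> : fst @` (fun p => way_below leXY p (x, y)) = (fun a => way_below leX a x).
    exact: wb_lub.
  apply/seteqP; split=> [_ [p /way_below_fst h <-] //|a ax].
  by exists (a, y0) => //; exact: way_below_pair.
suff -> : snd @` (fun p => way_below leXY p (x, y)) = (fun b => way_below leY b y).
  exact: wb_lub.
apply/seteqP; split=> [_ [p /way_below_snd h <-] //|b bx].
by exists (x0, b) => //; exact: way_below_pair.
Qed.

Lemma finite_join (a : X) (I : Type) (s : seq I) (h : I -> X) (Q : set I) :
  (forall i, Q i -> way_below leX (h i) a) ->
  exists2 c, way_below leX c a & forall i, List.In i s -> Q i -> leX (h i) c.
Proof.
have [_ [[x0 x0a] dir]] := wb_directed domX a.
move=> H; elim: s => [|i s [c ca IH]]; first by exists x0.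
have [Qi|nQi] := pselect (Q i).
  have [c' [c'a [ic' cc']]] := dir _ _ (H i Qi) ca.
  exists c' => // j [<-//|js] Qj; exact: dom_trans domX _ _ _ (IH j js Qj) cc'.
by exists c => // j [<-//|js]; exact: IH.
Qed.

(** A tube lemma. By the description of the way-below relation on pairs, an open set around [(a, b)]
    contains a point way below in both coordinates, so the tube over [a] can be taken above one [c]
    way below [a]. *)
Lemma prod_compact A B : scott_compact setT leX A -> scott_compact setT leY B ->
  scott_compact setT leXY (fun p => A p.1 /\ B p.2).
Proof.
move=> [_ kA] [_ kB]; split=> // I U oU cov.
have upper i p q : U i p -> leX p.1 q.1 -> leY p.2 q.2 -> U i q.
  by move=> Up h1 h2; have [_ [sat _]] := oU i; exact: (sat p).
have tube a : A a -> exists2 c, way_below leX c a & exists s : seq I,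
    forall x b, leX c x -> B b -> exists2 i, List.In i s & U i (x, b).
  move=> Aa.
  pose Q := [set k : X * Y * I | U k.2 k.1 /\ way_below leX k.1.1 a].
  have [k|b Bb|t Ht] := kB (X * Y * I)%type
      (fun k => up leY [set y | y = k.1.2 /\ Q k]).
  - exact: up_open.
  - have [i Ui] := cov (a, b) (conj Aa Bb).
    have [[a' b'] U' wab] := up_point prod_domain (oU i) Ui.
    exists (a', b', i); exists b'; first by split=> //; split=> //; exact: way_below_fst wab.
    exact: way_below_snd wab.
  - have [c ca cP] := @finite_join a _ t (fun k => k.1.1) Q (fun k => @proj2 _ _).
    exists c => //; exists (map snd t) => x b cx Bb.
    have [k [kt [_ [-> Qk] wkb]]] := Ht b Bb.
    exists k.2; first by apply/In_map; exists k.
    apply: (upper _ _ _ (proj1 Qk)) => /=; last exact: wb_le wkb.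
    exact: dom_trans domX _ _ _ (cP k kt Qk) cx.
pose Q := [set k : X * seq I | forall x b, leX k.1 x -> B b ->
  exists2 i, List.In i k.2 & U i (x, b)].
have [k|a Aa|t Ht] := kA (X * seq I)%type (fun k => up leX [set c | c = k.1 /\ Q k]).
- exact: up_open.
- by have [c ca [s Hs]] := tube a Aa; exists (c, s); exists c.
- exists (flatten (map snd t)) => -[a b] [/= Aa Bb].
  have [k [kt [_ [-> Qk] ka]]] := Ht a Aa.
  have [i ik Ui] := Qk a b (wb_le domX ka) Bb; exists i; split=> //.
  elim: t kt {Ht} => //= k' t IH [->|kt]; apply/In_cat; [by left|right; exact: IH].
Qed.

End ProductDomain.

Lemma coherent_principal (Y : Type) (le : Y -> Y -> Prop) p q : is_coherent_domain le ->
  scott_compact setT le (fun y => le p y /\ le q y).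
Proof.
move=> [domY coh].
have K r : scott_compact setT le (le r) /\ saturated setT le (le r).
  split; last by move=> x y rx _ xy; exact: dom_trans domY _ _ _ rx xy.
  split=> // I U oU cov; have [i Ui] := cov r (dom_refl domY r).
  by exists [:: i] => y ry; exists i; split; [left|exact: sopen_up (oU i) Ui ry].
by have [k1 s1] := K p; have [k2 s2] := K q; exact: coh.
Qed.

Lemma prod_coherent (X Y : Type) (leX : X -> X -> Prop) (leY : Y -> Y -> Prop) p q :
  is_coherent_domain leX -> is_coherent_domain leY ->
  scott_compact setT (prod_le leX leY) (fun r => prod_le leX leY p r /\ prod_le leX leY q r).
Proof.
move=> cX cY; have [[dX _] [dY _]] := (cX, cY).
have := prod_compact dX dY (coherent_principal p.1 q.1 cX) (coherent_principal p.2 q.2 cY).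
congr scott_compact; apply/funext => r; apply/propext.
by split=> -[[? ?] [? ?]].
Qed.

(** * Directed suprema in the powercones *)

Section Hull.
Variables (Y : Type) (le : Y -> Y -> Prop).
Notation C := (is_cval le).
Notation leV := (@le_val Y).

(** [Pmap] is the hull of an image and [basicP] the hull of a convex hull, so [hull_image] covers
    both functoriality and the formula on basic elements. *)
Definition hull (x : pkind) (A : set (valT Y)) : set (valT Y) :=
  match x with
  | Pl => scott_closure C leV A
  | Pu => upset C leV A
  | Pb => scott_closure C leV A `&` upset C leV A
  end.

Lemma sub_upset A : A `<=` C -> A `<=` upset C leV A.
Proof. by move=> sAC a Aa; split; [exact: sAC|exists a; split=> //; exact: le_val_refl]. Qed.

Lemma sub_downset A : A `<=` C -> A `<=` downset C leV A.
Proof. by move=> sAC a Aa; split; [exact: sAC|exists a; split=> //; exact: le_val_refl]. Qed.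

Lemma upset_sub A B : A `<=` upset C leV B -> upset C leV A `<=` upset C leV B.
Proof.
move=> AB y [Cy [a [/AB[Ca [b [Bb ba]]] ay]]]; split=> //; exists b; split=> //.
exact: le_val_trans ba ay.
Qed.

Lemma upset_mono A B : A `<=` B -> upset C leV A `<=` upset C leV B.
Proof. by move=> AB y [Cy [a [/AB Ba ay]]]; split=> //; exists a. Qed.

Lemma downset_closed_sub A B : scott_closed C leV B -> A `<=` B -> downset C leV A `<=` B.
Proof.
move=> /scott_closedVP[_ dn _] AB y [Cy [a [/AB Ba ya]]]; exact: (dn a).
Qed.

Lemma sub_hull x A : A `<=` C -> A `<=` hull x A.
Proof.
move=> sAC; case: x => /=; [exact: sub_scott_closure|exact: sub_upset|].
by move=> a Aa; split; [exact: sub_scott_closure|exact: sub_upset].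
Qed.

Lemma hull_sub_closure x A : (x = Pu -> False) -> hull x A `<=` scott_closure C leV A.
Proof. by case: x => /=; [move=> _ a|move=> /(_ erefl)|move=> _ a []]. Qed.

Lemma hull_sub_upset x A : (x = Pl -> False) -> hull x A `<=` upset C leV A.
Proof. by case: x => /=; [move=> /(_ erefl)|move=> _ a|move=> _ a []]. Qed.

Lemma validP_cval x A : validP le x A -> A `<=` C.
Proof.
by case: x => /=; [move=> [_ [[]]]|move=> [_ [[]]]|move=> [_ [_ [[]]]]].
Qed.

Lemma validP_convex x A : validP le x A -> convex A.
Proof. by case: x => /=; [move=> [_ []]|move=> [_ [_ []]]|move=> [_ []]]. Qed.

Lemma validP_nonempty x A : validP le x A -> exists mu, A mu.
Proof. by case: x => /= -[]. Qed.

Lemma closure_of_between A B : A `<=` B -> B `<=` scott_closure C leV A ->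
  scott_closure C leV B = scott_closure C leV A.
Proof.
move=> AB BA; apply/seteqP; split; last exact: scott_closure_mono.
by apply: scott_closure_sub => //; exact: scott_closure_closed.
Qed.

Lemma upset_of_between A B : A `<=` B -> B `<=` upset C leV A ->
  upset C leV B = upset C leV A.
Proof.
by move=> AB BA; apply/seteqP; split; [exact: upset_sub|exact: upset_mono].
Qed.

Lemma hull_upset x A : A `<=` C -> (x = Pl -> False) ->
  upset C leV (hull x A) = upset C leV A.
Proof.
by move=> sAC xl; apply: upset_of_between; [exact: sub_hull|exact: hull_sub_upset].
Qed.

Lemma hull_closure x A : A `<=` C -> (x = Pu -> False) ->
  scott_closure C leV (hull x A) = scott_closure C leV A.
Proof.
by move=> sAC xl; apply: closure_of_between; [exact: sub_hull|exact: hull_sub_closure].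
Qed.

End Hull.

(** A continuous map sends the closure into the closure of the image and upper sets into upper sets,
    so the inner hull is absorbed. *)
Lemma hull_image (Y Z : Type) (leY : Y -> Y -> Prop) (leZ : Z -> Z -> Prop) x h A :
  A `<=` is_cval leY -> vcont leY leZ h ->
  hull leZ x (h @` hull leY x A) = hull leZ x (h @` A).
Proof.
move=> sAC hc; have [h1 h2 _] := hc; have sub : h @` A `<=` h @` hull leY x A.
  by apply: image_subset; exact: sub_hull.
have cl : (x = Pu -> False) -> scott_closure (is_cval leZ) (@le_val Z) (h @` hull leY x A) =
    scott_closure (is_cval leZ) (@le_val Z) (h @` A).
  move=> xu; apply: closure_of_between => // y [mu Hm <-].
  by apply: (vcont_closure hc sAC); exists mu => //; exact: hull_sub_closure Hm.
have up : (x = Pl -> False) -> upset (is_cval leZ) (@le_val Z) (h @` hull leY x A) =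
    upset (is_cval leZ) (@le_val Z) (h @` A).
  move=> xl; apply: upset_of_between => // y [mu Hm <-].
  have [Cm [a [Aa am]]] := hull_sub_upset xl Hm.
  by split; [exact: h1|exists (h a); split; [exists a|apply: h2 => //; exact: sAC]].
case: x sub cl up => /= _ cl up; [exact: cl|exact: up|].
by rewrite cl// up.
Qed.

Lemma PmapE (Z : Type) (leZ : Z -> Z -> Prop) x (Y : Type) (g : valT Y -> valT Z) A :
  Pmap leZ x g A = hull leZ x (g @` A).
Proof. by case: x. Qed.

Lemma basicPE (Y : Type) (le : Y -> Y -> Prop) x F : basicP le x F = hull le x (conv F).
Proof. by case: x. Qed.

(** Coherence tested on two principal upper sets, a form that passes to products through
    [prod_compact]. *)
Definition coh_dom (Y : Type) (le : Y -> Y -> Prop) := forall p q,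
  scott_compact setT le (fun y => le p y /\ le q y).

Section Lubs.
Variables (Y : Type) (le : Y -> Y -> Prop) (domY : is_domain le).
Notation C := (is_cval le).
Notation leV := (@le_val Y).

Lemma validP_hull x A : (x = Pb -> coh_dom le) -> validP le x A -> hull le x A = A.
Proof.
case: x => [_ [_ [cA _]]|_ [_ [[sAC _] [sA _]]]|coh [_ [_ [lA oA]]]] /=.
- exact: scott_closed_closure.
- exact: upset_id.
have pA := lawson_patch_closed domY (coh erefl) lA; have [sAC _] := pA.
rewrite (patch_closed_closure domY pA).
apply/seteqP; split=> a; last by move=> Aa; split; [exact: sub_downset|exact: sub_upset].
move=> [[Ca [b [Ab ab]]] [_ [c [Ac ca]]]].
exact: (oA c a b).
Qed.

(** Bridges the order [leP], stated with lower sets, and [hull], which uses Scott closures. *)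
Lemma validP_downset x A : (x = Pb -> coh_dom le) -> (x = Pu -> False) ->
  validP le x A -> scott_closure C leV A = downset C leV A.
Proof.
case: x => [_ _ [_ [cA _]]|_ /(_ erefl)//|coh _ [_ [_ [lA oA]]]].
  by rewrite downset_id// scott_closed_closure.
apply: (patch_closed_closure domY).
exact: (lawson_patch_closed domY (coh erefl) lA).
Qed.

Lemma lawson_scott_compact A : lawson_compact C leV A -> scott_compact C leV A.
Proof.
move=> [sAC kA]; split=> // I U oU; apply: kA => i; exact: scott_lawson_open.
Qed.

Lemma upset_compact A : scott_compact C leV A -> scott_compact C leV (upset C leV A).
Proof.
move=> [sAC kA]; split; first by move=> mu [].
move=> I U oU cov; have [//|mu Am|s Hs] := kA I U.
  by apply: cov; exact: sub_upset.
exists s => nu [Cn [mu [Am mn]]]; have [i [si Ui]] := Hs _ Am.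
by exists i; split=> //; have [_ [sat _]] := oU i; exact: (sat mu).
Qed.

Lemma validP_upset_compact x A : (x = Pl -> False) -> validP le x A ->
  scott_compact C leV (upset C leV A).
Proof.
case: x => [/(_ erefl)//|_ [_ [kA _]]|_ [_ [_ [lA _]]]]; apply: upset_compact => //.
exact: lawson_scott_compact.
Qed.

(** * Lower and upper limits of a directed family *)

Section Family.
Variables (x : pkind) (FF : set (set (valT Y))).
Hypotheses (coh : x = Pb -> coh_dom le) (dF : directed (validP le x) (leP le x) FF).

Definition lower_limit := scott_closure C leV (\bigcup_(A in FF) downset C leV A).
Definition upper_limit := \bigcap_(A in FF) upset C leV A.

Lemma leP_downset A B : (x = Pu -> False) -> leP le x A B ->
  downset C leV A `<=` downset C leV B.
Proof. by case: x => /=; [move=> _ a|move=> /(_ erefl)|move=> _ []]. Qed.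

Lemma leP_upset A B : (x = Pl -> False) -> leP le x A B ->
  upset C leV B `<=` upset C leV A.
Proof. by case: x => /=; [move=> /(_ erefl)|move=> _ a|move=> _ []]. Qed.

Lemma union_downsets_convex : (x = Pu -> False) ->
  convex (\bigcup_(A in FF) downset C leV A).
Proof.
move=> xu mu nu t [A FA Am] [B FB Bn] t01; have [FP [_ dir]] := dF.
have [D [FD [AD BD]]] := dir _ _ FA FB; exists D => //.
apply: downset_convex => //; [|exact: validP_convex (FP _ FD)| |].
- exact: validP_cval (FP _ FD).
- exact: leP_downset AD _ Am.
- exact: leP_downset BD _ Bn.
Qed.

Lemma union_downsets_cval : \bigcup_(A in FF) downset C leV A `<=` C.
Proof. by move=> mu [A _ []]. Qed.

Lemma lower_limit_closed : scott_closed C leV lower_limit.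
Proof. exact: scott_closure_closed. Qed.

Lemma member_lower_limit A : FF A -> A `<=` lower_limit.
Proof.
move=> FA mu Am; have [FP _] := dF; apply: sub_scott_closure.
  exact: union_downsets_cval.
by exists A => //; apply: sub_downset => //; exact: validP_cval (FP _ FA).
Qed.

Lemma upper_limit_saturated : saturated C leV upper_limit.
Proof.
move=> mu nu Um Cn mn A FA; have := Um A FA => -[_ [a [Aa am]]].
by split=> //; exists a; split=> //; exact: le_val_trans am mn.
Qed.

Lemma upper_limit_well_filtered U : (x = Pl -> False) -> scott_open C leV U ->
  upper_limit `<=` U -> exists2 A, FF A & upset C leV A `<=` U.
Proof.
move=> xl oU H; have [FP [nF dir]] := dF.
apply: (well_filtered domY nF _ _ oU H).
  move=> A FA; split; last exact: upset_saturated.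
  exact: validP_upset_compact xl (FP _ FA).
move=> A B FA FB; have [D [FD [AD BD]]] := dir _ _ FA FB.
by exists D => // mu Dm; split; [exact: leP_upset AD _ Dm|exact: leP_upset BD _ Dm].
Qed.

Lemma upper_limit_cval : upper_limit `<=` C.
Proof. by move=> mu Um; have [_ [[A FA] _]] := dF; case: (Um A FA). Qed.

Lemma upper_limit_convex : convex upper_limit.
Proof.
move=> mu nu t Um Un t01 A FA; have [FP _] := dF.
apply: upset_convex => //; [exact: validP_cval (FP _ FA)|exact: validP_convex (FP _ FA)| |].
  exact: Um.
exact: Un.
Qed.

Lemma upper_limit_compact : (x = Pl -> False) -> scott_compact C leV upper_limit.
Proof.
move=> xl; split; first exact: upper_limit_cval.
move=> I U oU cov.
have [||A FA AU] := @upper_limit_well_filtered (\bigcup_(i in setT) U i) xl.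
- by apply: scott_open_bigcup => i _; exact: oU.
- by move=> mu /cov[i Ui]; exists i.
have [FP _] := dF; have [_ kA] := validP_upset_compact xl (FP _ FA).
have [|s Hs] := kA I U oU; first by move=> mu /AU[i _ Ui]; exists i.
by exists s => mu /(_ A FA); exact: Hs.
Qed.

Lemma upper_limit_nonempty : (x = Pl -> False) -> exists mu, upper_limit mu.
Proof.
move=> xl; apply: contrapT => nU; have [FP _] := dF.
have [|A FA A0] := upper_limit_well_filtered xl (scott_open0 C leV).
  by move=> mu Um; apply: nU; exists mu.
have [mu Am] := validP_nonempty (FP _ FA).
by apply: (A0 mu); apply: sub_upset => //; exact: validP_cval (FP _ FA).
Qed.

Definition limit_set := lower_limit `&` upper_limit.

(** Compactness of patch-closed sets. The choice of [Z] gives nonemptiness of the limit (all of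
    [C]), and the two halves of the order (a principal upper set, a principal lower set). *)
Lemma limit_set_meets Z A0 : x = Pb -> patch_closed le Z -> FF A0 ->
  (forall A, FF A -> leP le x A0 A -> exists2 a, A a & Z a) ->
  exists2 b, limit_set b & Z b.
Proof.
move=> xb pZ F0 H; have [FP [_ dir]] := dF.
have nl : x = Pl -> False by rewrite xb.
pose J := [set A | FF A /\ leP le x A0 A].
have J0 : exists A, J A by have [D [FD [AD _]]] := dir _ _ F0 F0; exists D.
have [A [FA _]|A [FA A0A]|A B [FA A0A] [FB A0B]|b Hb] :=
    @patch_closed_fip _ le _ J (fun A => (Z `&` lower_limit) `&` upset C leV A) J0.
- apply: patch_closedI; first apply: patch_closedI => //.
    exact: (patch_closed_scott domY (coh xb) lower_limit_closed).
  apply: (patch_closed_compact domY (coh xb)); last exact: upset_saturated.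
  exact: validP_upset_compact nl (FP _ FA).
- have [a Aa Za] := H A FA A0A; exists a; split.
    by split=> //; exact: member_lower_limit FA _ Aa.
  by apply: sub_upset => //; exact: validP_cval (FP _ FA).
- have [D [FD [AD BD]]] := dir _ _ FA FB.
  have [D' [FD' [DD' A0D']]] := dir _ _ FD F0.
  exists D' => // mu [ZL D'm]; have Dm := leP_upset nl DD' D'm.
  by split; split=> //; [exact: leP_upset AD _ Dm|exact: leP_upset BD _ Dm].
have [A1 JA1] := J0; have [[Zb Lb] _] := Hb _ JA1.
exists b => //; split=> // A FA.
have [D [FD [AD A0D]]] := dir _ _ FA F0.
by have [_ Db] := Hb D (conj FD A0D); exact: leP_upset AD _ Db.
Qed.

Lemma scott_closed_cval : scott_closed C leV C.
Proof. by apply/scott_closedVP; split=> // D dD _; exact: vsup_cval. Qed.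

Lemma lower_limit_convex : (x = Pu -> False) -> convex lower_limit.
Proof.
move=> xu; apply: scott_closure_convex; first exact: union_downsets_cval.
exact: union_downsets_convex.
Qed.

Lemma limit_set_valid : x = Pb -> validP le Pb limit_set.
Proof.
move=> xb; have [FP [[A0 F0] _]] := dF.
have nl : x = Pl -> False by rewrite xb.
have nu : x = Pu -> False by rewrite xb.
split.
  have [|A FA _|b Bb _] := limit_set_meets (Z := C) xb _ F0.
  - exact: (patch_closed_scott domY (coh xb) scott_closed_cval).
  - have [a Aa] := validP_nonempty (FP _ FA); exists a => //.
    exact: validP_cval (FP _ FA) _ Aa.
  - by exists b.
split.
  move=> mu nu' t [Lm Km] [Ln Kn] t01; split; first exact: lower_limit_convex.
  exact: upper_limit_convex.
split.
  apply: (patch_closed_lawson domY (coh xb)); apply: patch_closedI.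
    exact: (patch_closed_scott domY (coh xb) lower_limit_closed).
  apply: (patch_closed_compact domY (coh xb)); first exact: upper_limit_compact.
  exact: upper_limit_saturated.
move=> p q r [Lp Kp] [Lr Kr] Cq pq qr; split; last exact: (upper_limit_saturated Kp Cq pq).
have /scott_closedVP[_ dn _] := lower_limit_closed.
exact: (dn r).
Qed.

(** Any least upper bound lies below this [B], and is thereby controlled by the two limits. *)
Lemma limit_exists : exists B, [/\ validP le x B, forall A, FF A -> leP le x A B,
  (x = Pu -> False) -> downset C leV B `<=` lower_limit &
  (x = Pl -> False) -> upper_limit `<=` upset C leV B].
Proof.
have [FP [[A0 F0] dir]] := dF.
have FC A : FF A -> A `<=` C by move=> FA; exact: validP_cval (FP _ FA).
have dL A : FF A -> downset C leV A `<=` lower_limit.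
  by move=> FA; apply: downset_closed_sub lower_limit_closed _; exact: member_lower_limit.
have uU A : FF A -> upset C leV upper_limit `<=` upset C leV A.
  by move=> FA; apply: upset_sub => mu /(_ A FA).
have LC : lower_limit `<=` C by case: lower_limit_closed.
have [xE|[xE|xE]] : x = Pl \/ x = Pu \/ x = Pb by case: x; tauto.
- exists lower_limit; split; rewrite xE//.
  + split; first by have [a Aa] := validP_nonempty (FP _ F0); exists a; exact: member_lower_limit F0 _ Aa.
    by split; [exact: lower_limit_closed|apply: lower_limit_convex; rewrite xE].
  + by move=> A FA; apply: subset_trans (dL A FA) _; exact: sub_downset.
  + by move=> _; rewrite downset_id//; exact: lower_limit_closed.
- exists upper_limit; split; rewrite xE//.
  + split; first by apply: upper_limit_nonempty; rewrite xE.
    split; first by apply: upper_limit_compact; rewrite xE.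
    by split; [exact: upper_limit_saturated|exact: upper_limit_convex].
  + by move=> _; apply: sub_upset; exact: upper_limit_cval.
- have nl : x = Pl -> False by rewrite xE.
  have nu : x = Pu -> False by rewrite xE.
  exists limit_set; split; rewrite ?xE.
  + exact: limit_set_valid.
  + move=> A FA; split.
      move=> mu [Cm [a [Aa ma]]]; split=> //.
      have [|B FB AB|b Bb [_ [_ [-> mb]]]] :=
          limit_set_meets (Z := upset C leV [set mu]) xE _ FA; last by exists b.
        exact: (patch_closed_principal domY (coh xE) Cm).
      have [Ca [b [Bb ab]]] := leP_downset nu AB (sub_downset (FC _ FA) Aa).
      exists b => //; split; first exact: FC FB _ Bb.
      by exists mu; split=> //; exact: le_val_trans ma ab.
    apply: subset_trans (uU A FA); apply: upset_mono.
    by move=> mu [].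
  + by move=> _; apply: downset_closed_sub; [exact: lower_limit_closed|move=> mu []].
  + move=> _ nu' Kn; have Cn := upper_limit_cval Kn; split=> //.
    have [|A FA _|b Bb [_ [_ [-> bn]]]] :=
        limit_set_meets (Z := downset C leV [set nu']) xE _ F0; last by exists b.
      exact: (patch_closed_scott domY (coh xE) (principal_closed Cn)).
    have [_ [a [Aa an]]] := Kn A FA; exists a => //; split; first exact: FC FA _ Aa.
    by exists nu'.
Qed.

Lemma lub_sub_lower_limit A : (x = Pu -> False) ->
  is_lub (validP le x) (leP le x) FF A -> A `<=` lower_limit.
Proof.
move=> xu [vA [_ least]]; have [B [vB ubB lB _]] := limit_exists.
move=> mu Am; apply: (lB xu); apply: (leP_downset xu (least B vB ubB)).
by apply: sub_downset => //; exact: validP_cval vA.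
Qed.

Lemma upper_limit_sub_lub A : (x = Pl -> False) ->
  is_lub (validP le x) (leP le x) FF A -> upper_limit `<=` upset C leV A.
Proof.
move=> xl [vA [_ least]]; have [B [vB ubB _ uB]] := limit_exists.
by move=> mu /(uB xl); exact: leP_upset xl (least B vB ubB) mu.
Qed.

End Family.
End Lubs.

(** * The strength *)

Section Strength.
Variables (X Y : Type) (leX : X -> X -> Prop) (leY : Y -> Y -> Prop).
Hypotheses (domX : is_domain leX) (domY : is_domain leY).
Notation leXY := (prod_le leX leY).
Notation CY := (is_cval leY).
Notation CXY := (is_cval leXY).
Notation leVY := (@le_val Y).
Notation leVXY := (@le_val (X * Y)).

Definition point_tensor (a : X) := Vmap leXY (fun y : Y => (a, y)).

Lemma ocont_pair a : ocont leY leXY (fun y => (a, y)).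
Proof. by apply: scott_cont_ocont; apply: scott_cont_pair => b; exact: dom_refl. Qed.

Lemma point_tensor_vcont a : vcont leY leXY (point_tensor a).
Proof. exact: Vmap_vcont (ocont_pair a). Qed.

Lemma point_tensor_le a b mu : CY mu -> leX a b ->
  leVXY (point_tensor a mu) (point_tensor b mu).
Proof.
move=> Cm ab U; rewrite /point_tensor /Vmap; case: asboolP => // oU.
apply: (cval_le Cm); [exact: (ocont_pair a oU)|exact: (ocont_pair b oU)|].
by move=> y /= Uy; apply: sopen_up oU Uy _; split=> //; exact: dom_refl.
Qed.

Lemma point_tensor_mono a b mu nu : CY mu -> CY nu -> leX a b -> leVY mu nu ->
  leVXY (point_tensor a mu) (point_tensor b nu).
Proof.
move=> Cm Cn ab mn; apply: (@le_val_trans _ _ (point_tensor a nu)).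
  by have [_ h _] := point_tensor_vcont a; exact: h.
exact: point_tensor_le.
Qed.

(** The slice of an open set at [a] is the directed union of its slices at the points of [D], and
    [mu] is continuous. *)
Lemma point_tensor_sup (D : set X) a mu : directed setT leX D -> is_lub setT leX D a ->
  CY mu -> point_tensor a mu = vsup [set point_tensor b mu | b in D].
Proof.
move=> dD lD Cm; have [_ [[b0 D0] dir]] := dD; have [_ [ub _]] := lD.
apply: le_val_anti; last first.
  by apply: vsup_le => _ [b Db <-]; apply: point_tensor_le => //; exact: ub.
have Cb b : CXY (point_tensor b mu) by have [h _ _] := point_tensor_vcont b; exact: h.
move=> U; have [oU|nU] := pselect (sopen leXY U); last first.
  rewrite (cval_out (Cb a) nU); apply: le_trans (cval_ge0 (Cb b0) U) _.
  by apply: (@vsup_ub _ [set point_tensor b mu | b in D]); exists b0.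
have E : point_tensor a mu U = mu (\bigcup_(V in [set (fun y => U (b, y)) | b in D]) V).
  rewrite /point_tensor /Vmap asboolT//; congr mu; apply/seteqP.
  split=> [y Uay|y [_ [b Db <-] Uby]]; last first.
    by apply: (sopen_up oU Uby); split; [exact: ub|exact: dom_refl].
  have [||_ [[b Db <-] Uby]] := @scott_open_meets_directed _ setT leXY [set (b, y) | b in D] U (a, y) oU _ _ Uay.
  - split=> //; split; first by exists (b0, y), b0.
    move=> _ _ [b Db <-] [c Dc <-]; have [d [Dd [bd cd]]] := dir _ _ Db Dc.
    by exists (d, y); split; [exists d|split; split=> //; exact: dom_refl].
  - apply: (@lub_pair _ _ leX setT leY); first by rewrite image_comp /comp /= image_id.
    split=> //; split; first by move=> _ [_ [b _ <-] <-]; exact: dom_refl.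
    by move=> u _; apply; exists (b0, y) => //; exists b0.
  - by exists (fun y => U (b, y)) => //; exists b.
apply: lee_from_below => r; rewrite E => rU.
have E1 V : [set (fun y => U (b, y)) | b in D] V -> sopen leY V.
  by move=> [b _ <-]; exact: (ocont_pair b oU).
have E3 V W : [set (fun y => U (b, y)) | b in D] V -> [set (fun y => U (b, y)) | b in D] W ->
    exists Z, [set (fun y => U (b, y)) | b in D] Z /\ V `<=` Z /\ W `<=` Z.
  move=> [b Db <-] [c Dc <-]; have [d [Dd [bd cd]]] := dir _ _ Db Dc.
  exists (fun y => U (d, y)); split; first by exists d.
  by split=> y Uy; apply: (sopen_up oU Uy); split=> //; exact: dom_refl.
have [|_ [b Db <-] rb] := cval_cont Cm E1 _ E3 rU; first by exists (fun y => U (b0, y)), b0.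
apply: (@le_trans _ _ (point_tensor b mu U)).
  by rewrite /point_tensor /Vmap asboolT//; exact: ltW.
by apply: (@vsup_ub _ [set point_tensor b mu | b in D]); exists b.
Qed.

Lemma point_tensor_directed (D : set X) mu : directed setT leX D -> CY mu ->
  directed CXY leVXY [set point_tensor b mu | b in D].
Proof.
move=> [_ [[b0 D0] dir]] Cm; split.
  by move=> _ [b _ <-]; have [h _ _] := point_tensor_vcont b; exact: h.
split; first by exists (point_tensor b0 mu), b0.
move=> _ _ [b Db <-] [c Dc <-]; have [d [Dd [bd cd]]] := dir _ _ Db Dc.
exists (point_tensor d mu); split; first by exists d.
by split; exact: point_tensor_le.
Qed.

Definition strength x a A := PVmap x leXY (fun y : Y => (a, y)) A.

Lemma strengthE x a A : strength x a A = hull leXY x (point_tensor a @` A).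
Proof. exact: PmapE. Qed.

Lemma image_tensor_cval a A : A `<=` CY -> point_tensor a @` A `<=` CXY.
Proof. by move=> sAC _ [mu /sAC Cm <-]; have [h _ _] := point_tensor_vcont a; exact: h. Qed.

Section Kind.
Variable x : pkind.
Hypotheses (coh : x = Pb -> coh_dom leY) (cohXY : x = Pb -> coh_dom leXY).

Lemma strength_valid a A : validP leY x A -> validP leXY x (strength x a A).
Proof.
move=> vA; have sAC := validP_cval vA; have sgC := image_tensor_cval (a := a) sAC.
have cg : convex (point_tensor a @` A) by apply: Vmap_convex; exact: validP_convex vA.
have [m Am] := validP_nonempty vA.
have ne : exists mu, hull leXY x (point_tensor a @` A) mu.
  by exists (point_tensor a m); apply: sub_hull => //; exists m.
have kU : (x = Pl -> False) -> scott_compact CXY leVXY (upset CXY leVXY (point_tensor a @` A)).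
  (* Replacing [A] by its upper set, which is compact for both remaining kinds, does not change the
     upper set of the image. *)
  move=> xl; have -> : upset CXY leVXY (point_tensor a @` A) =
      upset CXY leVXY (point_tensor a @` upset CY leVY A).
    have hc := point_tensor_vcont a; have [h1 h2 _] := hc.
    apply/esym; apply: upset_of_between; first by apply: image_subset; exact: sub_upset.
    move=> _ [mu [Cm [b [Ab bm]]] <-]; split; first exact: h1.
    by exists (point_tensor a b); split; [exists b|apply: h2 => //; exact: sAC].
  by apply: (vcont_compact (point_tensor_vcont a)); exact: validP_upset_compact vA.
have cC := scott_closure_convex sgC cg; have cU := upset_convex sgC cg.
have dom := prod_domain domX domY.
rewrite strengthE; have [xE|[xE|xE]] : x = Pl \/ x = Pu \/ x = Pb by case: x; tauto.
- rewrite xE /= in ne *; split=> //; split=> //; exact: scott_closure_closed.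
- have {}kU : scott_compact CXY leVXY (upset CXY leVXY (point_tensor a @` A)).
    by apply: kU; rewrite xE.
  rewrite xE /= in ne *; split=> //; split=> //; split=> //; exact: upset_saturated.
have {}kU : scott_compact CXY leVXY (upset CXY leVXY (point_tensor a @` A)).
  by apply: kU; rewrite xE.
have cXY := cohXY xE; rewrite xE /= in ne *; split=> //; split.
  by move=> mu nu t [? ?] [? ?] t01; split; [exact: cC|exact: cU].
split.
  apply: (patch_closed_lawson dom cXY); apply: patch_closedI.
    exact: (patch_closed_scott dom cXY (scott_closure_closed _ _ _)).
  exact: (patch_closed_compact dom cXY kU (@upset_saturated _ _ _)).
move=> p q r [_ Up] [cr _] Cq pq qr; split; last exact: (upset_saturated Up Cq pq).
have /scott_closedVP[_ dn _] := scott_closure_closed CXY leVXY (point_tensor a @` A).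
exact: (dn r).
Qed.

Lemma strength_downset a A : (x = Pu -> False) -> validP leY x A ->
  downset CXY leVXY (strength x a A) = scott_closure CXY leVXY (point_tensor a @` A).
Proof.
move=> xu vA; have sgC := image_tensor_cval (a := a) (validP_cval vA).
rewrite -(validP_downset (prod_domain domX domY) cohXY xu (strength_valid a vA)).
by rewrite strengthE hull_closure.
Qed.

Lemma strength_upset a A : (x = Pl -> False) -> validP leY x A ->
  upset CXY leVXY (strength x a A) = upset CXY leVXY (point_tensor a @` A).
Proof. by move=> xl /validP_cval sAC; rewrite strengthE hull_upset//; exact: image_tensor_cval. Qed.

(** Lets the three kinds be treated at once, each half of the order being proved where it is part of
    [leP]. *)
Lemma leP_intro (Z : Type) (leZ : Z -> Z -> Prop) A B :
  ((x = Pu -> False) -> downset (is_cval leZ) (@le_val Z) A `<=` downset (is_cval leZ) (@le_val Z) B) ->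
  ((x = Pl -> False) -> upset (is_cval leZ) (@le_val Z) B `<=` upset (is_cval leZ) (@le_val Z) A) ->
  leP leZ x A B.
Proof.
by case: x => /= h1 h2; [exact: h1|exact: h2|split; [exact: h1|exact: h2]].
Qed.

Lemma strength_mono a b A B : validP leY x A -> validP leY x B ->
  leX a b -> leP leY x A B -> leP leXY x (strength x a A) (strength x b B).
Proof.
move=> vA vB ab AB; have sA := validP_cval vA; have sB := validP_cval vB.
apply: leP_intro => h.
  rewrite !strength_downset//; apply: scott_closure_sub; first exact: scott_closure_closed.
  move=> _ [mu Am <-]; have [Cm [nu [Bn mn]]] := leP_downset h AB (sub_downset sA Am).
  have /scott_closedVP[_ dn _] := scott_closure_closed CXY leVXY (point_tensor b @` B).
  apply: (dn (point_tensor b nu)).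
  - by apply: sub_scott_closure; [exact: image_tensor_cval|exists nu].
  - by have [h1 _ _] := point_tensor_vcont a; exact: h1.
  - by apply: point_tensor_mono => //; exact: sB.
rewrite !strength_upset//; apply: upset_sub => _ [nu Bn <-].
have [Cn [mu [Am mn]]] := leP_upset h AB (sub_upset sB Bn).
split; first by have [h1 _ _] := point_tensor_vcont b; exact: h1.
exists (point_tensor a mu); split; first by exists mu.
by apply: point_tensor_mono => //; exact: sA.
Qed.

Notation PP := (fun p : X * set (valT Y) => validP leY x p.2).
Notation leD := (prod_le leX (leP leY x)).

(** * Strength of a directed supremum of pairs *)

Section Lub.
Variables (D : set (X * set (valT Y))) (s : X * set (valT Y)).
Hypotheses (dD : directed PP leD D) (lD : is_lub PP leD D s).
Let d1 := directed_fst dD.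
Let d2 := directed_snd dD.
Let l1 := lub_fst lD.
Let l2 := lub_snd lD.

(** The preimage of [u] under tensoring with [s.1] is closed, so it is enough that it contains the
    lower sets of the family; there [s.1] is replaced by the supremum of the first components. *)
Lemma strength_lub_lower u : (x = Pu -> False) -> scott_closed CXY leVXY u ->
  (forall p, D p -> point_tensor p.1 @` p.2 `<=` u) -> point_tensor s.1 @` s.2 `<=` u.
Proof.
move=> xu cu H _ [al Aal <-]; have [DP [_ dir]] := dD.
have hc := point_tensor_vcont s.1.
have sub : \bigcup_(A in snd @` D) downset CY leVY A `<=` CY `&` point_tensor s.1 @^-1` u.
  move=> mu [_ [p Dp <-] [Cm [b [pb mb]]]]; split=> //=.
  have /scott_closedVP[_ dn cl] := cu.
  rewrite (point_tensor_sup d1 l1 Cm); apply: cl; first exact: point_tensor_directed.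
  move=> _ [_ [q Dq <-] <-].
  (* The valuation comes from [p] and the point from [q]; a pair above both dominates their
     tensor. *)
  have [r [Dr [[pr1 pr2] [qr1 qr2]]]] := dir _ _ Dp Dq.
  have Cb : CY b := validP_cval (DP _ Dp) pb.
  have [_ [c [rc bc]]] := leP_downset xu pr2 (sub_downset (validP_cval (DP _ Dp)) pb).
  have Cc : CY c := validP_cval (DP _ Dr) rc.
  apply: (dn (point_tensor r.1 c)).
  - by apply: (H r Dr); exists c.
  - by have [h1 _ _] := point_tensor_vcont q.1; exact: h1.
  - by apply: point_tensor_mono => //; exact: le_val_trans mb bc.
have := lub_sub_lower_limit domY coh d2 xu l2 Aal.
by move=> /(scott_closure_sub (vcont_closed hc cu) sub)[].
Qed.

(** [W b] consists of the [mu] whose tensor with [b] is not below [nu]. If the claim failed, these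
    open sets would cover the upper limit, hence the upper set of one member, hence finitely many
    would do. *)
Lemma strength_lub_upper nu : (x = Pl -> False) -> CXY nu ->
  (forall p, D p -> upset CXY leVXY (point_tensor p.1 @` p.2) nu) ->
  upset CXY leVXY (point_tensor s.1 @` s.2) nu.
Proof.
move=> xl Cn H; apply: contrapT => nnu; have [DP [_ dir]] := dD.
pose W b : set (valT Y) :=
  CY `&` point_tensor b @^-1` (CXY `\` downset CXY leVXY [set nu]).
have WE b mu : CY mu -> (W b mu <-> ~ leVXY (point_tensor b mu) nu).
  move=> Cm; have Cb : CXY (point_tensor b mu) by have [h1 _ _] := point_tensor_vcont b; exact: h1.
  split; first by move=> [_ [_ nd]] le; apply: nd; split=> //; exists nu.
  by move=> nle; split=> //; split=> // -[_ [_ [->]]].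
have oW b : scott_open CY leVY (W b).
  by apply: (vcont_open (point_tensor_vcont b)); case: (principal_closed Cn).
have [||_ [p Dp <-] pW] := @upper_limit_well_filtered _ _ domY x (snd @` D) d2
    (\bigcup_(p in D) W p.1) xl.
- by apply: scott_open_bigcup => p _; exact: oW.
- move=> mu Um; have Cm : CY mu := upper_limit_cval d2 Um.
  have [_ [al [Aal am]]] := upper_limit_sub_lub domY coh d2 xl l2 Um.
  apply: contrapT => nW; apply: nnu; split=> //.
  exists (point_tensor s.1 al); split; first by exists al.
  have Ca : CY al := validP_cval (proj1 l2) Aal.
  apply: (@le_val_trans _ _ (point_tensor s.1 mu)).
    by have [_ h2 _] := point_tensor_vcont s.1; exact: h2.
  rewrite (point_tensor_sup d1 l1 Cm); apply: vsup_le => _ [_ [q Dq <-] <-].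
  by apply: contrapT => /WE Wq; apply: nW; exists q => //; exact: Wq.
have [_ kp] := validP_upset_compact xl (DP _ Dp).
have [q|mu /pW[q Dq Wq]|t Ht] := kp _ (fun q => if `[< D q >] then W q.1 else set0).
- by case: asboolP => _; [exact: oW|exact: scott_open0].
- by exists q; rewrite asboolT.
(* Above [p] and these finitely many pairs, [r] provides a valuation whose tensor is below [nu],
   although the cover places it in some [W q.1] with [q.1] below [r.1]. *)
have [r Dr [pr tr]] : exists2 r, D r & leD p r /\ forall q, List.In q t -> D q -> leX q.1 r.1.
  elim: t {Ht} => [|q t [r Dr [pr tr]]].
    by have [r [Dr [pr _]]] := dir _ _ Dp Dp; exists r.
  have leD_trans r' : leX r.1 r'.1 -> forall q', List.In q' t -> D q' -> leX q'.1 r'.1.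
    by move=> rr q' qt Dq'; apply: dom_trans domX _ _ _ (tr q' qt Dq') rr.
  have [Dq|nDq] := pselect (D q); last by exists r => //; split=> // q' [<-//|]; exact: tr.
  have [r' [Dr' [[rr1 rr2] [qr1 _]]]] := dir _ _ Dr Dq.
  exists r' => //; split; last by move=> q' [<-//|qt] Dq'; exact: leD_trans rr1 _ qt Dq'.
  have [pr1 pr2] := pr; split; first exact: dom_trans domX _ _ _ pr1 rr1.
  apply: leP_intro => h.
    by apply: subset_trans (leP_downset h pr2) (leP_downset h rr2).
  by apply: subset_trans (leP_upset h rr2) (leP_upset h pr2).
have [_ [_ [[al ral <-] aln]]] := H r Dr.
have Ca : CY al := validP_cval (DP _ Dr) ral.
have pal : upset CY leVY p.2 al.
  by apply: (leP_upset xl (proj2 pr)); apply: sub_upset ral; exact: validP_cval (DP _ Dr).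
have [q [qt]] := Ht _ pal; case: asboolP => // Dq /(WE _ _ Ca); apply.
exact: le_val_trans (point_tensor_le Ca (tr q qt Dq)) aln.
Qed.

Lemma strength_lub : is_lub (validP leXY x) (leP leXY x)
  ((fun p => strength x p.1 p.2) @` D) (strength x s.1 s.2).
Proof.
have [DP _] := dD; have [vs [ub _]] := lD; split; first exact: strength_valid.
split.
  by move=> _ [p Dp <-]; have [h1 h2] := ub p Dp; apply: strength_mono => //; exact: DP.
move=> u vu uu; have dom := prod_domain domX domY.
have uu' p : D p -> leP leXY x (strength x p.1 p.2) u by move=> Dp; apply: uu; exists p.
apply: leP_intro => h.
  (* The lower set of a valid element coincides with its closure, so [strength_lub_lower] applies to
     it. *)
  have cu : scott_closed CXY leVXY (downset CXY leVXY u).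
    by rewrite -(validP_downset dom cohXY h vu); exact: scott_closure_closed.
  rewrite strength_downset//; apply: scott_closure_sub => //.
  apply: strength_lub_lower => // p Dp.
  apply: subset_trans (leP_downset h (uu' p Dp)); rewrite strength_downset//; last exact: DP.
  by apply: sub_scott_closure; apply: image_tensor_cval; exact: validP_cval (DP _ Dp).
rewrite strength_upset// => nu Un; apply: strength_lub_upper => //; first by case: Un.
move=> p Dp; rewrite -strength_upset//; last exact: DP.
exact: (leP_upset h (uu' p Dp)).
Qed.

End Lub.

Lemma strength_scott_cont : scott_cont PP leD (validP leXY x) (leP leXY x)
  (fun p => strength x p.1 p.2).
Proof.
split; first by move=> p; exact: strength_valid.
split; first by move=> p q vp vq [h1 h2]; exact: strength_mono.
exact: strength_lub.
Qed.

End Kind.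

Lemma strength_basic x a (F : seq (seq (ERreal * Y))) :
  (forall s, List.In s F -> nonneg_coeffs s) ->
  strength x a (basicP leY x [seq simple leY s | s <- F]) =
  basicP leXY x [seq simple leXY (tensor a s) | s <- F].
Proof.
move=> F0; rewrite strengthE !basicPE hull_image.
- rewrite Vmap_conv -map_comp; congr (hull _ _ (conv _)).
  apply: eq_map => s /=; rewrite Vmap_simple//; exact: ocont_pair.
- by apply: conv_cval => _ /In_map[s sF <-]; apply: simple_cval; exact: F0.
- exact: point_tensor_vcont.
Qed.

End Strength.

(** * Functoriality and the strength axioms *)

Lemma PVmap_comp x (X Y Z : Type) (leX : X -> X -> Prop) (leY : Y -> Y -> Prop)
    (leZ : Z -> Z -> Prop) (f : X -> Y) (g : Y -> Z) A :
  ocont leX leY f -> ocont leY leZ g -> A `<=` is_cval leX ->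
  PVmap x leZ g (PVmap x leY f A) = PVmap x leZ (g \o f) A.
Proof.
move=> cf cg sAC; rewrite /PVmap !PmapE hull_image.
- rewrite image_comp; congr hull; apply: eq_imagel => mu _ /=.
  by rewrite Vmap_comp.
- by move=> _ [mu /sAC Cm <-]; have [h _ _] := Vmap_vcont cf; exact: h.
- exact: Vmap_vcont.
Qed.

Lemma PVmap_id x (X : Type) (le : X -> X -> Prop) A :
  is_domain le -> (x = Pb -> coh_dom le) -> validP le x A -> PVmap x le id A = A.
Proof.
move=> dom coh vA; rewrite /PVmap PmapE -[RHS](validP_hull dom coh vA).
congr hull; apply/seteqP; split.
  by move=> _ [mu Am <-]; rewrite Vmap_id//; exact: validP_cval vA _ Am.
by move=> mu Am; exists mu => //; rewrite Vmap_id//; exact: validP_cval vA _ Am.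
Qed.

Lemma good_dom_domain x (X : Type) (le : X -> X -> Prop) : good_dom x le -> is_domain le.
Proof. by case: x => // -[]. Qed.

Lemma good_dom_coherent x (X : Type) (le : X -> X -> Prop) :
  good_dom x le -> x = Pb -> coh_dom le.
Proof. by move=> + xE; rewrite xE => cX p q; exact: coherent_principal. Qed.

Lemma good_dom_prod_coherent x (X Y : Type) (leX : X -> X -> Prop) (leY : Y -> Y -> Prop) :
  good_dom x leX -> good_dom x leY -> x = Pb -> coh_dom (prod_le leX leY).
Proof. by move=> + + xE; rewrite xE => cX cY p q; exact: prod_coherent. Qed.

Theorem mainTheorem1 (x : pkind) :
  exists str : str_family,
  (* str_{X,Y} is a well-defined Scott-continuous map
     X x P_xV(Y) -> P_xV(X x Y), given on basic elements by the formula *)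
  (forall (X Y : Type) (leX : X -> X -> Prop) (leY : Y -> Y -> Prop),
     good_dom x leX -> good_dom x leY ->
     scott_cont (fun p : X * set (valT Y) => validP leY x p.2)
                (prod_le leX (leP leY x))
                (validP (prod_le leX leY) x) (leP (prod_le leX leY) x)
                (fun p => str X Y leX leY p.1 p.2) /\
     (forall (a : X) (F : seq (seq (ERreal * Y))),
        F <> [::] -> (forall s, List.In s F -> nonneg_coeffs s) ->
        str X Y leX leY a (basicP leY x [seq simple leY s | s <- F]) =
        basicP (prod_le leX leY) x
          [seq simple (prod_le leX leY) (tensor a s) | s <- F])) /\
  (* naturality in X and Y *)
  (forall (X Y X' Y' : Type) (leX : X -> X -> Prop) (leY : Y -> Y -> Prop)
          (leX' : X' -> X' -> Prop) (leY' : Y' -> Y' -> Prop)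
          (f : X -> X') (g : Y -> Y'),
     good_dom x leX -> good_dom x leY -> good_dom x leX' -> good_dom x leY' ->
     scott_cont setT leX setT leX' f -> scott_cont setT leY setT leY' g ->
     forall (a : X) (A : set (valT Y)), validP leY x A ->
       str X' Y' leX' leY' (f a) (PVmap x leY' g A) =
       PVmap x (prod_le leX' leY') (fun p => (f p.1, g p.2))
             (str X Y leX leY a A)) /\
  (* unit axiom:  P_xV(pi_2) o str_{1,Y} = pi_2 *)
  (forall (Y : Type) (leY : Y -> Y -> Prop), good_dom x leY ->
     forall A : set (valT Y), validP leY x A ->
       PVmap x leY snd (str unit Y unit_le leY tt A) = A) /\
  (* associativity axiom *)
  (forall (X Y Z : Type) (leX : X -> X -> Prop) (leY : Y -> Y -> Prop)
          (leZ : Z -> Z -> Prop),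
     good_dom x leX -> good_dom x leY -> good_dom x leZ ->
     forall (a : X) (b : Y) (A : set (valT Z)), validP leZ x A ->
       PVmap x (prod_le leX (prod_le leY leZ)) (@assoc3 X Y Z)
             (str (X * Y)%type Z (prod_le leX leY) leZ (a, b) A) =
       str X (Y * Z)%type leX (prod_le leY leZ) a (str Y Z leY leZ b A)).

Proof.
exists (fun X Y leX leY a A => PVmap x (prod_le leX leY) (fun y : Y => (a, y)) A).
split.
  move=> X Y leX leY gX gY.
  have [dX dY] := (good_dom_domain gX, good_dom_domain gY).
  split; last by move=> a F _ F0; exact: strength_basic.
  apply: strength_scott_cont => //; first exact: good_dom_coherent gY.
  exact: good_dom_prod_coherent gX gY.
have op X Y (leX : X -> X -> Prop) (leY : Y -> Y -> Prop) a :
    good_dom x leX -> ocont leY (prod_le leX leY) (fun y : Y => (a, y)).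
  by move=> gX; apply: ocont_pair; exact: good_dom_domain gX.
split.
  move=> X Y X' Y' leX leY leX' leY' f g gX gY gX' gY' cf cg a A vA.
  have sAC := validP_cval vA.
  have ofg := scott_cont_ocont (scott_cont_prod cf cg).
  have og := scott_cont_ocont cg.
  (* Both sides become the image under [y => (f a, g y)]. *)
  by rewrite (PVmap_comp x og (op _ _ _ leY' (f a) gX') sAC)
    (PVmap_comp x (op _ _ _ leY a gX) ofg sAC).
split.
  move=> Y leY gY A vA; have sAC := validP_cval vA; have dY := good_dom_domain gY.
  have ou : ocont leY (prod_le unit_le leY) (fun y : Y => (tt, y)).
    by apply: scott_cont_ocont; exact: scott_cont_pair.
  have os := scott_cont_ocont (@scott_cont_snd _ _ unit_le leY).
  (* The composite is convertible to [id]. *)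
  rewrite (PVmap_comp x ou os sAC).
  apply: PVmap_id => //; exact: good_dom_coherent gY.
move=> X Y Z leX leY leZ gX gY gZ a b A vA; have sAC := validP_cval vA.
have dXY := prod_domain (good_dom_domain gX) (good_dom_domain gY).
have oab : ocont leZ (prod_le (prod_le leX leY) leZ) (fun z : Z => ((a, b), z)).
  by apply: ocont_pair.
have oas := scott_cont_ocont (scott_cont_assoc3 leX leY leZ).
(* Both sides become the image under [z => (a, (b, z))]. *)
by rewrite (PVmap_comp x oab oas sAC)
  (PVmap_comp x (op _ _ _ leZ b gY) (op _ _ _ (prod_le leY leZ) a gX) sAC).
Qed.
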